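(* Let $G$ be a finite abelian group, $A=\mathrm{Hom}(G,\Bbbk^\times)$, $\beta$ a bicharacter on $G$. Let $(\Gamma,L)$ be a matched pair of finite groups, $H=\Bbbk^L\#\Bbbk\Gamma$ the associated Hopf algebra (with trivial cocycles), and $\rho:A\to\mathrm{Aut}_{\mathrm{ext}}H$ a morphism of groups; endow $H$ with the induced $G$-grading. Then the following are equivalent: (i) $H$ is a $(G,\beta)$-color Hopf algebra; (ii) $\beta(g,h)=1$ for all $g,h\in\sup H$; (iii) $(\Gamma,L)$, together with $\rho$, is a $(G,\beta)$-color matched pair.
   Context: $\Bbbk$ is an algebraically closed field of characteristic $0$. A bicharacter is a map $\beta:G\times G\to\Bbbk^\times$ multiplicative in each variable; $\chi:G\to A$ is $\chi_g(h)=\beta(h,g)$. A $(G,\beta)$-color Hopf algebra is a Hopf algebra in the braided category of $G$-graded vector spaces with braiding $c(v\otimes w)=\beta(|v|,|w|)w\otimes v$ for homogeneous $v,w$ of degrees $|v|,|w|$ (antipode bijective). A matched pair of groups $(\Gamma,L)$: finite groups $\Gamma,L$ with a right action $\lhd:L\times\Gamma\to L$ and a left action $\rhd:L\times\Gamma\to\Gamma$ (on sets) with $l\rhd\gamma\eta=(l\rhd\gamma)((l\lhd\gamma)\rhd\eta)$ and $lt\lhd\gamma=(l\lhd(t\rhd\gamma))(t\lhd\gamma)$ for $l,t\in L$, $\gamma,\eta\in\Gamma$. $H=\Bbbk^L\#\Bbbk\Gamma$ is the Hopf algebra with basis $\delta_le_\gamma$ ($l\in L,\gamma\in\Gamma$),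 product $(\delta_le_\gamma)(\delta_te_\eta)=\delta_{l\lhd\gamma,t}\,\delta_le_{\gamma\eta}$ (the first $\delta$ is a Kronecker delta) and coproduct $\Delta(\delta_le_\gamma)=\sum_{u\in L}\delta_ue_{(u^{-1}l)\rhd\gamma}\otimes\delta_{u^{-1}l}e_\gamma$. $\Bbbk^L$ is identified with the span of the elements $\delta_l=\delta_le_1$. $\mathrm{Aut}_{\mathrm{ext}}H$ is the group of Hopf algebra automorphisms $f$ of $H$ with $f(\Bbbk^L)\subseteq\Bbbk^L$. Every $f\in\mathrm{Aut}_{\mathrm{ext}}H$ has the form $f(\delta_le_\gamma)=\widetilde f_\gamma(f_1(l))\,\delta_{f_1(l)}e_{f_2(\gamma)}$ with unique $f_1\in\mathrm{Aut}\,L$, $f_2\in\mathrm{Aut}\,\Gamma$ and scalars $\widetilde f_\gamma(l)\in\Bbbk^\times$. For $a\in A$ write $a$ also for $\rho(a)$, and $a_1,a_2,\widetilde a_\gamma(l)$ for the corresponding data. Grading and support: $H_g=\{x\in H:\rho(a)(x)=a(g)x\ \forall a\in A\}$ and $\sup H=\{g\in G:H_g\ne0\}$. For $l\in L,\gamma\in\Gamma$: $A^l_\gamma=\{a\in A:a_1(l)=l,\ a_2(\gamma)=\gamma\}$; $G^l_\gamma=\{g\in G:\chi_g\in A^l_\gamma\}$; $\varphi^l_\gamma:A^l_\gamma\to\Bbbk^\times$, $\varphi^l_\gamma(a)=\widetilde a_\gamma(l)$ (a character); $\chi^l_\gamma:G^l_\gamma\to\Bbbk^\times$, $\chi^l_\gamma(g)=\varphi^l_\gamma(\chi_g)$;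 $\rho^l_\gamma:A\to\mathrm{Hom}(G^l_\gamma,\Bbbk^\times)$, $\rho^l_\gamma(a)=a|_{G^l_\gamma}$. For a subgroup $N\le G$, $N^\perp=\{a\in A:a|_N=1\}$. A $(G,\beta)$-color matched pair is a matched pair $(\Gamma,L)$ with a morphism of groups $\rho:A\to\mathrm{Aut}_{\mathrm{ext}}H$ such that for all $u,l\in L$ and $\eta,\gamma\in\Gamma$: (1) $(G^u_\eta)^\perp\subseteq A^l_\gamma$; (2) $A^l_\gamma\cap(\rho^u_\eta)^{-1}(\chi^u_\eta)\ne\emptyset$; (3) if $a\in A^l_\gamma\cap(\rho^u_\eta)^{-1}(\chi^u_\eta)$, then $\widetilde a_\gamma(l)=1$. *)

(* Defs.v *)
From HB Require Import structures.
From mathcomp Require Import all_boot all_order all_algebra all_fingroup.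

Set Implicit Arguments.
Unset Strict Implicit.
Unset Printing Implicit Defensive.

Import GRing.Theory.
Local Open Scope ring_scope.

(* [vec k I] is the [k]-vector space with basis [bv i], [i : I].  The tensor
   product of [vec k I] and [vec k J] is [vec k (I * J)], with
   [bv i (x) bv j = bv (i, j)]. *)

Notation vec k I := {ffun I -> k^o}.

Section Vec.
Variable k : fieldType.

Definition bv (I : finType) (i : I) : vec k I := [ffun j => (j == i)%:R].

Section Lext.
Variables (I : finType) (W : vectType k) (f : I -> W).

Definition lext_fun (v : vec k I) : W := \sum_i v i *: f i.

Fact lext_fun_is_linear : linear lext_fun.
Proof.
move=> a u v; rewrite /lext_fun scaler_sumr -big_split; apply: eq_bigr => i _.
by rewrite !ffunE /= scalerDl scalerA.
Qed.

HB.instance Definition _ :=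
  GRing.isLinear.Build k (vec k I) W _ lext_fun lext_fun_is_linear.

(* The linear map sending the basis vector [bv i] to [f i]. *)
Definition lext : 'Hom(vec k I, W) := linfun lext_fun.

Lemma lextE v : lext v = \sum_i v i *: f i.
Proof. by rewrite lfunE. Qed.

Lemma lext_bv i : lext (bv i) = f i.
Proof.
rewrite lextE (bigD1 i) //= ffunE eqxx scale1r big1 ?addr0 // => j /negbTE ji.
by rewrite ffunE ji scale0r.
Qed.

End Lext.

Definition tens (I J : finType) (v : vec k I) (w : vec k J) : vec k (I * J) :=
  [ffun p => (v p.1 : k) * w p.2].

Definition tensmap (I J I' J' : finType)
    (f : 'Hom(vec k I, vec k I')) (g : 'Hom(vec k J, vec k J')) :
    'Hom(vec k (I * J), vec k (I' * J')) :=
  lext (fun p : I * J => tens (f (bv p.1)) (g (bv p.2))).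

Definition tassoc (I J K : finType) :
    'Hom(vec k (I * J * K), vec k (I * (J * K))) :=
  lext (fun p : I * J * K => bv (p.1.1, (p.1.2, p.2))).

(* [f (x) id] and [id (x) f] for a linear form [f], after the identification
   of [k (x) V] and of [V (x) k] with [V]. *)
Definition contractl (I J : finType) (f : 'Hom(vec k I, k^o)) :
    'Hom(vec k (I * J), vec k J) :=
  lext (fun p : I * J => f (bv p.1) *: bv p.2).
Definition contractr (I J : finType) (f : 'Hom(vec k J, k^o)) :
    'Hom(vec k (I * J), vec k I) :=
  lext (fun p : I * J => f (bv p.2) *: bv p.1).

(* [id (x) c (x) id] on [(V (x) V) (x) (V (x) V)], for [c] an endomorphism of
   [V (x) V]. *)
Definition midmap (I : finType) (c : 'End(vec k (I * I))) :
    'End(vec k ((I * I) * (I * I))) :=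
  lext (fun p : (I * I) * (I * I) =>
    \sum_(q : I * I) c (bv (p.1.2, p.2.1)) q *: bv ((p.1.1, q.1), (q.2, p.2.2))).

Record bialg_maps (I : finType) := BialgMaps {
  mulm : 'Hom(vec k (I * I), vec k I);
  unitv : vec k I;
  comulm : 'Hom(vec k I, vec k (I * I));
  counitm : 'Hom(vec k I, k^o)
}.

Record is_algebra (I : finType) (B : bialg_maps I) : Prop := IsAlgebra {
  alg_mulA : forall x y z : vec k I,
    mulm B (tens (mulm B (tens x y)) z) = mulm B (tens x (mulm B (tens y z)));
  alg_mul1 : forall x, mulm B (tens (unitv B) x) = x;
  alg_mulr1 : forall x, mulm B (tens x (unitv B)) = x
}.

Record is_coalgebra (I : finType) (B : bialg_maps I) : Prop := IsCoalgebra {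
  coalg_comulA : forall x : vec k I,
    tassoc I I I (tensmap (comulm B) \1%VF (comulm B x)) =
    tensmap \1%VF (comulm B) (comulm B x);
  coalg_counitl : forall x, contractl I (counitm B) (comulm B x) = x;
  coalg_counitr : forall x, contractr I (counitm B) (comulm B x) = x
}.

(* An automorphism of bialgebras; between Hopf algebras it automatically
   commutes with the antipodes. *)
Record is_hopf_aut (I : finType) (B : bialg_maps I) (f : 'End(vec k I)) :
    Prop := IsHopfAut {
  haut_bij : bijective f;
  haut_mul : forall x y, f (mulm B (tens x y)) = mulm B (tens (f x) (f y));
  haut_unit : f (unitv B) = unitv B;
  haut_comul : forall x, comulm B (f x) = tensmap f f (comulm B x);
  haut_counit : forall x, counitm B (f x) = counitm B x
}.

Definition is_char (G : finGroupType) (f : {ffun G -> k}) :=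
  [forall x, f x != 0] && [forall x, forall y, f (x * y)%g == f x * f y].

(* [Hom(G, k^x)].  The defining condition is a boolean, so that characters
   with the same values are equal. *)
Record char (G : finGroupType) :=
  Char { char_val :> {ffun G -> k}; charP : is_char char_val }.

Fact char_mul_subproof (G : finGroupType) (a b : char G) :
  is_char [ffun x => a x * b x].
Proof.
have /andP[/forallP a0 /forallP aM] := charP a.
have /andP[/forallP b0 /forallP bM] := charP b.
apply/andP; split; first by apply/forallP => x; rewrite ffunE mulf_neq0.
apply/forallP => x; apply/forallP => y; rewrite !ffunE.
by rewrite (eqP (forallP (aM x) y)) (eqP (forallP (bM x) y)) mulrACA.
Qed.

Definition char_mul (G : finGroupType) (a b : char G) : char G :=
  Char (char_mul_subproof a b).

Record bichar (G : finGroupType) := Bichar {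
  bichar_val :> G -> G -> k;
  bichar_neq0 : forall x y, bichar_val x y != 0;
  bichar_mull : forall x y z,
    bichar_val (x * y)%g z = bichar_val x z * bichar_val y z;
  bichar_mulr : forall x y z,
    bichar_val x (y * z)%g = bichar_val x y * bichar_val x z
}.

Fact chi_subproof (G : finGroupType) (beta : bichar G) (g : G) :
  is_char [ffun h => beta h g].
Proof.
apply/andP; split; first by apply/forallP => x; rewrite ffunE bichar_neq0.
by apply/forallP => x; apply/forallP => y; rewrite !ffunE bichar_mull.
Qed.

Definition chi (G : finGroupType) (beta : bichar G) (g : G) : char G :=
  Char (chi_subproof beta g).

Section Color.
Variables (G : finGroupType) (beta : bichar G) (I : finType).

(* [gr g x] means that [x] belongs to the component of degree [g]. *)
Implicit Types gr : G -> vec k I -> Prop.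

Record is_grading gr : Prop := IsGrading {
  grading_0 : forall g, gr g 0;
  grading_lin : forall g (c : k) x y, gr g x -> gr g y -> gr g (c *: x + y);
  grading_dec : forall x, exists! xs : {ffun G -> vec k I},
    (forall g, gr g (xs g)) /\ x = \sum_g xs g
}.

(* The component of degree [g] of the tensor square, i.e. the sum over
   [h * h' = g] of the tensor products of the components of degrees [h, h']. *)
Definition tens_gr gr (g : G) (t : vec k (I * I)) : Prop :=
  exists (n : nat) (h h' : 'I_n -> G) (v w : 'I_n -> vec k I),
    (forall i, [/\ gr (h i) (v i), gr (h' i) (w i) & (h i * h' i)%g = g]) /\
    t = \sum_i tens (v i) (w i).

Definition is_braiding gr (c : 'End(vec k (I * I))) : Prop :=
  forall g h v w, gr g v -> gr h w -> c (tens v w) = beta g h *: tens w v.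

(* A Hopf algebra in the category of [G]-graded vector spaces braided by
   [beta]: all structure maps have degree 1.  The braiding [c] of the
   underlying graded space is determined by [is_braiding] once [gr] is a
   grading, hence the existential quantifier in [color_braided]. *)
Record color_hopf (B : bialg_maps I) gr : Prop := ColorHopf {
  color_grading : is_grading gr;
  color_mul_gr : forall g h x y,
    gr g x -> gr h y -> gr (g * h)%g (mulm B (tens x y));
  color_unit_gr : gr 1%g (unitv B);
  color_comul_gr : forall g x, gr g x -> tens_gr gr g (comulm B x);
  color_counit_gr : forall g x, gr g x -> g != 1%g -> counitm B x = 0;
  color_algebra : is_algebra B;
  color_coalgebra : is_coalgebra B;
  color_braided : exists c, is_braiding gr c /\
    forall x y, comulm B (mulm B (tens x y)) =
      tensmap (mulm B) (mulm B)
        (midmap c (tens (comulm B x) (comulm B y)));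
  color_comul1 : comulm B (unitv B) = tens (unitv B) (unitv B);
  color_counitM : forall x y,
    counitm B (mulm B (tens x y)) = counitm B x * counitm B y;
  color_counit1 : counitm B (unitv B) = 1;
  color_antipode : exists S : 'End(vec k I),
    [/\ bijective S,
        forall g x, gr g x -> gr g (S x),
        forall x, mulm B (tensmap S \1%VF (comulm B x)) =
                  (counitm B x : k) *: unitv B
      & forall x, mulm B (tensmap \1%VF S (comulm B x)) =
                  (counitm B x : k) *: unitv B]
}.

Definition graded_support gr (g : G) : Prop := exists2 x, gr g x & x != 0.

End Color.

End Vec.

Record matched_pair (Gam L : finGroupType) := MatchedPair {
  ract : L -> Gam -> L;
  lact : L -> Gam -> Gam;
  ract1 : forall l, ract l 1%g = l;
  ractM : forall l x y, ract l (x * y)%g = ract (ract l x) y;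
  lact1 : forall x, lact 1%g x = x;
  lactM : forall l t x, lact (l * t)%g x = lact l (lact t x);
  lact_mul : forall l x y,
    lact l (x * y)%g = (lact l x * lact (ract l x) y)%g;
  ract_mul : forall l t x,
    ract (l * t)%g x = (ract l (lact t x) * ract t x)%g
}.

Section Bismash.
Variables (k : fieldType) (Gam L : finGroupType) (M : matched_pair Gam L).

(* [bvH l x] is the basis element usually written [delta_l e_x]. *)
Definition bvH (l : L) (x : Gam) : vec k (L * Gam) := bv k (l, x).

Definition bismash : bialg_maps k (L * Gam)%type := {|
  mulm := lext (fun p : (L * Gam) * (L * Gam) =>
    if ract M p.1.1 p.1.2 == p.2.1 then bvH p.1.1 (p.1.2 * p.2.2)%g else 0);
  unitv := \sum_(l : L) bvH l 1%g;
  comulm := lext (fun p : L * Gam =>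
    \sum_(u : L) tens (bvH u (lact M (u^-1 * p.1)%g p.2))
                      (bvH (u^-1 * p.1)%g p.2));
  counitm := lext (fun p : L * Gam => (p.1 == 1%g)%:R : k^o)
|}.

Definition fun_space : {vspace vec k (L * Gam)} :=
  <<[seq bvH l 1%g | l : L]>>%VS.

Definition is_ext_aut (f : 'End(vec k (L * Gam))) : Prop :=
  is_hopf_aut bismash f /\ (f @: fun_space <= fun_space)%VS.

Record ext_data := ExtData {
  ext1 : {perm L};
  ext2 : {perm Gam};
  ext_scal : Gam -> L -> k
}.

Record ext_data_of (f : 'End(vec k (L * Gam))) (d : ext_data) : Prop :=
    ExtDataOf {
  ext1_aut : ext1 d \in Aut [set: L];
  ext2_aut : ext2 d \in Aut [set: Gam];
  ext_scal_neq0 : forall x l, ext_scal d x l != 0;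
  ext_dataE : forall l x,
    f (bvH l x) =
    ext_scal d x (ext1 d l) *: bvH (ext1 d l) (ext2 d x)
}.

Section ColorMatchedPair.
Variables (G : finGroupType) (beta : bichar k G).

(* [is_rho_hom rho]: [rho] is a morphism of groups from [Hom(G, k^x)] to the
   group (under composition) of automorphisms satisfying [is_ext_aut]. *)
Definition is_rho_hom (rho : char k G -> 'End(vec k (L * Gam))) : Prop :=
  (forall a, is_ext_aut (rho a)) /\
  (forall a b, rho (char_mul a b) = (rho a \o rho b)%VF).

Definition induced_gr (rho : char k G -> 'End(vec k (L * Gam)))
    (g : G) (x : vec k (L * Gam)) : Prop :=
  forall a : char k G, rho a x = a g *: x.

Section Stab.
Variable D : char k G -> ext_data.

(* The subgroups and characters written A^l_x, G^l_x, phi^l_x and chi^l_x, and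
   the inverse image of chi^l_x under the restriction map
   rho^l_x : Hom(G, k^x) -> Hom(G^l_x, k^x). *)
Definition stabA (l : L) (x : Gam) (a : char k G) : Prop :=
  ext1 (D a) l = l /\ ext2 (D a) x = x.

Definition stabG (l : L) (x : Gam) (g : G) : Prop := stabA l x (chi beta g).

Definition phi_lx (l : L) (x : Gam) (a : char k G) : k := ext_scal (D a) x l.

Definition chi_lx (l : L) (x : Gam) (g : G) : k := phi_lx l x (chi beta g).

Definition rho_preim (l : L) (x : Gam) (a : char k G) : Prop :=
  forall g, stabG l x g -> a g = chi_lx l x g.

Definition orth (N : G -> Prop) (a : char k G) : Prop :=
  forall g, N g -> a g = 1.

Record color_conditions : Prop := ColorConditions {
  color_cond1 : forall (u l : L) (y x : Gam) (a : char k G),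
    orth (stabG u y) a -> stabA l x a;
  color_cond2 : forall (u l : L) (y x : Gam),
    exists a : char k G, stabA l x a /\ rho_preim u y a;
  color_cond3 : forall (u l : L) (y x : Gam) (a : char k G),
    stabA l x a -> rho_preim u y a -> ext_scal (D a) x l = 1
}.

End Stab.

(* The data of an automorphism satisfying [is_ext_aut] exist and are unique,
   so the existential quantifier ranges over a single family of data. *)
Definition color_matched_pair (rho : char k G -> 'End(vec k (L * Gam))) :
    Prop :=
  is_rho_hom rho /\
  exists D : char k G -> ext_data,
    (forall a, ext_data_of (rho a) (D a)) /\ color_conditions D.

End ColorMatchedPair.
End Bismash.

(* Main.v *)
From HB Require Import structures.
Require Import Defs.
From mathcomp Require Import all_boot all_order all_algebra all_fingroup.
From mathcomp Require Import cyclic mxrepresentation.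
Import Defs GRing.Theory.
Local Open Scope ring_scope.

Set Implicit Arguments.
Unset Strict Implicit.
Unset Printing Implicit Defensive.

(** On basis elements, each coordinate of the braided product of coproducts is
    a single coordinate of the braiding.  The bialgebra maps therefore determine
    the braiding, and as [H] is an ordinary bialgebra it must be the flip, which
    means that [beta] is trivial on the support.  Conversely, if [beta] is
    trivial on the support then the flip is the braiding, and all structure maps
    are homogeneous because every [rho a] is a Hopf algebra automorphism.

    The degrees occurring in the orbit of [delta_l e_x] under [A] form the set
    [S^l_x] of those [g] with [a g = phi^l_x a] for all [a] in [A^l_x], a coset
    of the orthogonal of [A^l_x].  By the duality between [G] and [A], the
    orthogonal of [G^u_y] is the image under [beta] of the orthogonal of
    [A^u_y], and the [a] restricting to [chi^u_y] on [G^u_y] are exactly the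
    [beta h _] with [h] in [S^u_y].  Conditions (1)-(3) thus say that such a
    [beta h _] lies in [A^l_x] and is killed by [phi^l_x], which amounts to
    [beta h g = 1] for all [g] in [S^l_x]. *)

(** * Characters *)

Section CharBasics.
Variables (k : fieldType) (G : finGroupType).
Implicit Types a b : char k G.

HB.instance Definition _ := [isSub for @char_val k G].
HB.instance Definition _ := [Choice of char k G by <:].

Lemma char_eqP a b : (forall g, a g = b g) -> a = b.
Proof. by move=> ab; apply/val_inj/ffunP. Qed.

Lemma char_neq0 a g : a g != 0.
Proof. by case/andP: (Defs.charP a) => /forallP. Qed.

Lemma charM a g h : a (g * h)%g = a g * a h.
Proof. by case/andP: (Defs.charP a) => _ /forallP/(_ g)/forallP/(_ h)/eqP. Qed.

Lemma char1 a : a 1%g = 1.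
Proof. by apply: (mulfI (char_neq0 a 1%g)); rewrite -charM mulg1 mulr1. Qed.

Lemma charX a g n : a (g ^+ n)%g = a g ^+ n.
Proof. by elim: n => [|n IH]; rewrite ?char1 // expgS exprS charM IH. Qed.

Lemma charV a g : a (g^-1)%g = (a g)^-1.
Proof.
by apply: (mulfI (char_neq0 a g)); rewrite -charM mulgV char1 mulfV ?char_neq0.
Qed.

Lemma is_charP (f : {ffun G -> k}) :
  (forall g, f g != 0) -> (forall g h, f (g * h)%g = f g * f h) -> is_char f.
Proof.
move=> f0 fM; apply/andP; split; first exact/forallP.
by apply/forallP => g; apply/forallP => h; rewrite fM.
Qed.

Fact char_one_subproof : is_char [ffun g : G => 1 : k].
Proof. by apply: is_charP => *; rewrite !ffunE ?oner_neq0 ?mulr1. Qed.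

Fact char_inv_subproof a : is_char [ffun g => (a g)^-1].
Proof.
by apply: is_charP => *; rewrite !ffunE ?invr_eq0 ?char_neq0 // charM invfM.
Qed.

Fact char_mulA : associative (@char_mul k G).
Proof. by move=> a b c; apply: char_eqP => g; rewrite !ffunE mulrA. Qed.

Fact char_mul1 : left_id (Char char_one_subproof) (@char_mul k G).
Proof. by move=> a; apply: char_eqP => g; rewrite !ffunE mul1r. Qed.

Fact char_mulV : left_inverse (Char char_one_subproof)
  (fun a => Char (char_inv_subproof a)) (@char_mul k G).
Proof. by move=> a; apply: char_eqP => g; rewrite !ffunE mulVf ?char_neq0. Qed.

End CharBasics.

(** * Finiteness, orthogonality and duality for the character group *)

Section CharGroup.
Variables (k : closedFieldType) (G : finGroupType).

(** Over a closed field ['X^(n.+1) - 1] splits, and its roots form the list. Values of characters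
    are roots of unity of order dividing [#|G|], so this bound makes [char k G] a finite type. *)
Lemma unity_roots_exist n : {rs : seq k | forall z, z ^+ n.+1 = 1 -> z \in rs}.
Proof.
have [rs E] := closed_field_poly_normal ('X^(n.+1) - 1 : {poly k}).
rewrite lead_coefXnsubC // scale1r in E.
by exists rs => z zn; rewrite -root_prod_XsubC -E rootE hornerD hornerN hornerXn
  hornerC zn subrr.
Qed.

Definition char_values : seq k := sval (unity_roots_exist #|G|.-1).

Lemma char_valuesP (a : char k G) g : a g \in char_values.
Proof.
apply: (svalP (unity_roots_exist _)); rewrite prednK; last by apply/card_gt0P;
  exists 1%g.
by rewrite -cardsT -charX expg_cardG ?inE // char1.
Qed.

Definition char_code (a : char k G) : {ffun G -> 'I_(size char_values).+1} :=
  [ffun g => inord (index (a g) char_values)].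

Definition char_decode (t : {ffun G -> 'I_(size char_values).+1}) :
  option (char k G) := insub [ffun g => nth 0 char_values (t g)].

Fact char_codeK : pcancel char_code char_decode.
Proof.
move=> a; rewrite /char_decode; set f := finfun _.
have -> : f = val a.
  apply/ffunP => g; rewrite !ffunE inordK ?nth_index ?char_valuesP //.
  by rewrite ltnS index_size.
by rewrite valK.
Qed.

HB.instance Definition _ : isCountable (char k G) := PCanIsCountable char_codeK.
HB.instance Definition _ : isFinite (char k G) := PCanIsFinite char_codeK.
HB.instance Definition _ := Finite_isGroup.Build (char k G)
  (@char_mulA k G) (@char_mul1 k G) (@char_mulV k G).

Lemma charMl (a b : char k G) g : (a * b)%g g = a g * b g.
Proof. by rewrite ffunE. Qed.

Lemma charVl (a : char k G) g : (a^-1)%g g = (a g)^-1.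
Proof. by rewrite ffunE. Qed.

Lemma char1l g : (1%g : char k G) g = 1.
Proof. by rewrite ffunE. Qed.

Hypothesis char_k : [pchar k] =i pred0.

Lemma natr_card_neq0 (T : finType) (x : T) : #|T|%:R != 0 :> k.
Proof. by rewrite (pcharf0P _).1 // -lt0n; apply/card_gt0P; exists x. Qed.

(** If [a h] differs from 1, translating the summation by [h] multiplies the sum by [a h], so the
    sum vanishes. *)
Lemma char_sum (a : char k G) : \sum_g a g = (#|G| * (a == 1%g))%:R.
Proof.
have [->|/eqP a1] := eqVneq a 1%g.
  rewrite muln1 (eq_bigr (fun=> 1)) => [|g _]; last exact: char1l.
  by rewrite sumr_const.
have /existsP[h ah] : [exists h, a h != 1].
  apply: contra_notT a1 => /existsPn a1; apply: char_eqP => g.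
  by rewrite char1l; apply/eqP; rewrite -[_ == _]negbK a1.
rewrite muln0; apply/eqP; move: ah; rewrite -subr_eq0.
apply: contraNT => s0; apply/eqP/(mulIf s0).
rewrite mul0r mulrBl mul1r; apply/eqP; rewrite subr_eq0; apply/eqP.
rewrite mulr_sumr [RHS](reindex_inj (mulgI h)) /=.
by apply: eq_bigr => g _; rewrite charM.
Qed.

(** Multiplying a vanishing combination by [b^-1] and summing over the group isolates [#|G| * c b]
    by orthogonality, and [#|G|] is nonzero in characteristic 0. *)
Lemma char_independent (c : char k G -> k) b :
  c b != 0 -> exists g, \sum_a c a * a g != 0.
Proof.
move=> cb; apply/existsP; apply: contraNT cb => /existsPn c0.
have [b' b'P] : exists b', forall a, (a * b' == 1)%g = (a == b).
  by exists (b^-1)%g => a; rewrite -eq_mulgV1.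
have /eqP: \sum_g (\sum_a c a * a g) * b' g = 0.
  by rewrite big1 // => g _; move: (c0 g); rewrite negbK => /eqP ->;
    rewrite mul0r.
under eq_bigr do rewrite mulr_suml; rewrite exchange_big.
under eq_bigr do (under eq_bigr do rewrite -mulrA -charMl;
  rewrite -mulr_sumr char_sum b'P).
rewrite (bigD1 b) //= eqxx muln1 big1 ?addr0 => [|a /negbTE->]; last first.
  by rewrite muln0 mulr0.
by rewrite mulf_eq0 (negbTE (natr_card_neq0 1%g)) orbF.
Qed.

(** Independence, applied to the coefficients [(phi a)^-1] on [N] extended by 0, gives a [g] at
    which the combination is nonzero. Translation by [b] in [N] shows that [b g] and [phi b]
    multiply this nonzero value to the same result, so they coincide. *)
Lemma subgroup_char_eval (N : {group char k G}) (phi : char k G -> k) :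
    {in N, forall a, phi a != 0} ->
      {in N &, {morph phi : a b / (a * b)%g >-> a * b}} ->
  exists g : G, {in N, forall a : char k G, a g = phi a}.
Proof.
move=> phi0 phiM; pose c a := if a \in N then (phi a)^-1 else 0.
have [|g sg] := @char_independent c 1%g.
  by rewrite /c group1 invr_eq0 phi0.
exists g => b Nb; apply/esym/eqP; move: sg; apply: contraNT => bg.
rewrite -(inj_eq (mulfI (phi0 _ Nb))) mulr0 -subr_eq0.
have E : b g * \sum_a c a * a g = phi b * \sum_a c a * a g.
  rewrite [in RHS](reindex_inj (mulgI b)) !mulr_sumr; apply: eq_bigr => a _ /=.
  rewrite /c groupMl //; case: ifP => Na; last by rewrite !mul0r !mulr0.
  by rewrite charMl phiM // invfM -!mulrA mulVKf ?phi0 // mulrCA.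
rewrite -(inj_eq (mulfI (_ : phi b - b g != 0))) ?subr_eq0 //.
by rewrite subr0 mulr0 mulrCA mulrBl E subrr mulr0.
Qed.

(** For the indicator of [N] minus that of the coset of [a], the combination at [g] factors as
    [1 - a g] times the sum [s] over [N]. Where it is nonzero, [a g] differs from 1, and [s != 0]
    forces [b g = 1] on [N], since translation by [b] multiplies [s] by [b g]. *)
Lemma subgroup_separate (N : {group char k G}) (a : char k G) : a \notin N ->
  exists2 g : G, {in N, forall b : char k G, b g = 1} & a g != 1.
Proof.
move=> Na; pose c b := (b \in N)%:R - ((a^-1 * b)%g \in N)%:R : k.
have [|g sg] := @char_independent c 1%g.
  by rewrite /c group1 mulg1 groupV (negbTE Na) subr0 oner_neq0.
pose s := \sum_(b in N) b g.
have {sg} sg : (1 - a g) * s != 0.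
  move: sg; congr (_ != 0); rewrite mulrBl mul1r /s mulr_sumr.
  under eq_bigr do rewrite mulrBl; rewrite sumrB; congr (_ - _).
    by rewrite [RHS]big_mkcond; apply: eq_bigr => b _; case: ifP => _ /=;
      rewrite ?mul1r ?mul0r.
  rewrite [RHS]big_mkcond (reindex_inj (mulgI a)); apply: eq_bigr => b _ /=.
  by rewrite mulKg charMl; case: ifP => _ /=; rewrite ?mul1r ?mul0r.
move: sg; rewrite mulf_eq0 negb_or subr_eq0 eq_sym => /andP[ag s0].
exists g => // b Nb; apply: (mulIf s0); rewrite mul1r mulr_sumr.
rewrite /s [RHS](reindex_inj (mulgI b)) /= [in RHS](eq_bigl (mem N)) => [|x];
  last by rewrite groupMl.
by apply: eq_bigr => x _; rewrite charMl.
Qed.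

(** In the regular representation, which is faithful, the image of [rG g - 1] is nonzero, and it is
    a submodule because the group is abelian. It contains a simple submodule, which is a line, and
    the eigenvalues on that line form the character. *)
Lemma char_separate (abG : abelian [set: G]) g : g != 1%g ->
  exists a : char k G, a g != 1.
Proof.
move=> g1; pose rG := regular_repr k [set: G]%G.
pose U := rG g - 1%:M.
have comU h : U *m rG h = rG h *m U.
  by rewrite mulmxBl mulmxBr mul1mx mulmx1 -!repr_mxM ?inE // (centsP abG) ?inE.
have modU : mxmodule rG U.
  by apply/mxmoduleP => h _; rewrite comU submxMl.
have U0 : U != 0.
  rewrite subr_eq0; apply: contraNneq g1 => rg.
  have := regular_mx_faithful k [set: G]%G;
    rewrite /mx_faithful /= => /subsetP/(_ g).
  by rewrite !inE mul1mx rg eqxx => /(_ isT).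
have [V simV sVU] := dec_mxsimple_exists modU U0.
have rV : \rank V = 1%N.
  apply: mxsimple_abelian_linear abG simV; exact: group_closure_closed_field.
have [modV V0 _] := simV.
pose v := nz_row V.
have v0 : v != 0 by rewrite nz_row_eq0.
have vV : (V <= v)%MS.
  by rewrite -mxrank_leqif_sup ?nz_row_sub // rV rank_rV v0.
have ev h : exists z, v *m rG h == z *: v.
  have := submx_trans (submx_trans (submxMr _ (nz_row_sub V))
    (mxmoduleP modV h (in_setT h))) vV.
  by case/sub_rVP => z ->; exists z.
pose z h := xchoose (ev h).
have zE h : v *m rG h = z h *: v by apply/eqP/(xchooseP (ev h)).
have scalI : injective (fun z : k => z *: v).
  by move=> x y /eqP; rewrite -subr_eq0 -scalerBl scaler_eq0 (negbTE v0) orbF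
    subr_eq0 => /eqP.
have zM x y : z (x * y)%g = z x * z y.
  apply: scalI; rewrite -zE repr_mxM ?inE // mulmxA zE -scalemxAl zE scalerA
    mulrC //.
have z1 : z 1%g = 1 by apply: scalI; rewrite -zE repr_mx1 mulmx1 scale1r.
have z0 h : z h != 0.
  by apply/eqP => zh; have := zM h h^-1%g; rewrite mulgV z1 zh mul0r => /eqP;
    rewrite oner_eq0.
have charz : is_char [ffun h => z h].
  by apply: is_charP => *; rewrite !ffunE ?z0.
exists (Char charz); rewrite ffunE; apply/eqP => zg.
(* If [g] fixed [v], a preimage [w] of [v] under [U] would satisfy [w *m rG (g ^+ n) = w + v *+ n].
   Taking for [n] the order of [g] makes a positive multiple of [v] vanish, which is impossible in
   characteristic 0. *)
have [w vw] : exists w, v = w *m U.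
  exact/submxP/(submx_trans (nz_row_sub V)).
have fixv : v *m rG g = v by rewrite zE zg scale1r.
have stepw n : w *m rG (g ^+ n)%g = w + v *+ n.
  elim: n => [|n IH]; first by rewrite repr_mx1 mulmx1 addr0.
  rewrite expgSr repr_mxM ?inE // mulmxA IH mulmxDl mulrSr addrCA.
  have -> : w *m rG g = w + v by rewrite vw mulmxBr mulmx1 addrC subrK.
  by rewrite -!scaler_nat -scalemxAl fixv addrC.
have := stepw #[g]%g; rewrite expg_order repr_mx1 mulmx1 => /eqP.
rewrite -subr_eq0 opprD addNKr oppr_eq0 -scaler_nat scaler_eq0 (negbTE v0) orbF.
by rewrite (pcharf0P _).1 // -leqn0 leqNgt order_gt0.
Qed.

End CharGroup.

(** * Free vector spaces and their tensor products *)

Section VecTheory.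
Variable k : fieldType.
Implicit Types I J K : finType.

Lemma bvE I (i j : I) : bv k i j = (j == i)%:R :> k.
Proof. by rewrite ffunE. Qed.

Lemma bv_neq0 I (i : I) : bv k i != 0.
Proof.
by apply/eqP => /ffunP/(_ i)/eqP; rewrite !ffunE eqxx oner_eq0.
Qed.

Lemma scale_bv_inj I (c d : k) (i j : I) :
  c != 0 -> c *: bv k i = d *: bv k j -> i = j /\ c = d.
Proof.
move=> c0 /ffunP E; have := E i; rewrite !ffunE eqxx.
case: eqVneq => [->|_]; rewrite /GRing.scale /= ?mulr1 // mulr0 => /eqP.
by rewrite (negbTE c0).
Qed.

Lemma vec_bvE I (v : vec k I) : v = \sum_i (v i : k) *: bv k i.
Proof.
apply/ffunP => j; rewrite sum_ffunE (bigD1 j) //= big1 => [|i ij].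
  by rewrite ffunE bvE eqxx addr0 [_ *: _]mulr1.
by rewrite ffunE bvE eq_sym (negbTE ij) [_ *: _]mulr0.
Qed.

Lemma vec_linE I (c : k) (u v : vec k I) i :
  (c *: u + v) i = c * u i + v i :> k.
Proof. by rewrite !ffunE. Qed.

Lemma vec_neq0P I (v : vec k I) : v != 0 -> exists i, v i != 0.
Proof.
move=> v0; apply/existsP; apply: contraNT v0 => /existsPn v0.
by apply/eqP/ffunP => i; rewrite ffunE; apply/eqP; rewrite -[_ == _]negbK v0.
Qed.

(** Extension by linearity as an elimination rule, for multilinear identities that are not stated as
    equalities of linear maps. *)
Lemma vec_ind I (P : vec k I -> Prop) :
    (forall c u v, P u -> P v -> P (c *: u + v)) -> P 0 ->
  (forall i, P (bv k i)) -> forall v, P v.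
Proof.
move=> Plin P0 Pbv v; rewrite (vec_bvE v).
elim/big_rec: _ => // i u _; exact: Plin.
Qed.

Lemma hom_lin (V W : vectType k) (f : 'Hom(V, W)) c u v :
  f (c *: u + v) = c *: f u + f v.
Proof. exact: linearP. Qed.

Lemma hom0 (V W : vectType k) (f : 'Hom(V, W)) : f 0 = 0.
Proof. exact: linear0. Qed.

Lemma homZ (V W : vectType k) (f : 'Hom(V, W)) c u : f (c *: u) = c *: f u.
Proof. exact: linearZ_LR. Qed.

Lemma hom_sum (V W : vectType k) (f : 'Hom(V, W)) (T : finType) (P : pred T) F :
  f (\sum_(i | P i) F i) = \sum_(i | P i) f (F i).
Proof. exact: linear_sum. Qed.

Lemma hom_bv_ext I (W : vectType k) (f g : 'Hom(vec k I, W)) :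
  (forall i, f (bv k i) = g (bv k i)) -> f = g.
Proof.
move=> fg; apply/lfunP; apply: vec_ind => // [c u v fu fv|].
  by rewrite !hom_lin fu fv.
by rewrite !hom0.
Qed.

Section Tens.
Variables I J : finType.
Implicit Types (v : vec k I) (w : vec k J).

Lemma tensE v w p : tens v w p = (v p.1 : k) * w p.2.
Proof. by rewrite ffunE. Qed.

Fact tens_is_linear v : linear (tens v : vec k J -> vec k (I * J)).
Proof.
move=> c w w'; apply/ffunP => p; rewrite !ffunE.
by rewrite mulrDr /GRing.scale /= mulrCA.
Qed.
HB.instance Definition _ v :=
  GRing.isLinear.Build k (vec k J) (vec k (I * J)) _ (tens v)
    (tens_is_linear v).

(** A copy of [tens] with swapped arguments, on which linearity in the first factor can be
    declared. *)
Definition tensr w v : vec k (I * J) := tens v w.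

Fact tensr_is_linear w : linear (tensr w : vec k I -> vec k (I * J)).
Proof.
move=> c v v'; apply/ffunP => p; rewrite !ffunE.
by rewrite mulrDl /GRing.scale /= mulrA.
Qed.
HB.instance Definition _ w :=
  GRing.isLinear.Build k (vec k I) (vec k (I * J)) _ (tensr w)
    (tensr_is_linear w).

Lemma tens_linl c v v' w : tens (c *: v + v') w = c *: tens v w + tens v' w.
Proof. exact: (linearP (tensr w)). Qed.

Lemma tens_linr c v w w' : tens v (c *: w + w') = c *: tens v w + tens v w'.
Proof. exact: linearP. Qed.

Lemma tens0l w : tens (0 : vec k I) w = 0.
Proof. exact: (linear0 (tensr w)). Qed.

Lemma tens0r v : tens v (0 : vec k J) = 0.
Proof. exact: linear0. Qed.

Lemma tensZl c v w : tens (c *: v) w = c *: tens v w.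
Proof. exact: (linearZ_LR (tensr w)). Qed.
Lemma tensZr c v w : tens v (c *: w) = c *: tens v w.
Proof. exact: linearZ_LR. Qed.

Lemma tens_suml (T : finType) (P : pred T) (F : T -> vec k I) w :
  tens (\sum_(i | P i) F i) w = \sum_(i | P i) tens (F i) w.
Proof. exact: (linear_sum (tensr w)). Qed.

Lemma tens_sumr (T : finType) (P : pred T) (F : T -> vec k J) v :
  tens v (\sum_(i | P i) F i) = \sum_(i | P i) tens v (F i).
Proof. exact: linear_sum. Qed.

Lemma tens_bv i j : tens (bv k (i : I)) (bv k (j : J)) = bv k (i, j).
Proof. by apply/ffunP => -[a b]; rewrite !ffunE -natrM mulnb. Qed.

Lemma tens_neq0 v w : v != 0 -> w != 0 -> tens v w != 0.
Proof.
move=> /vec_neq0P[i vi] /vec_neq0P[j wj]; apply/eqP => /ffunP/(_ (i, j))/eqP.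
by rewrite !ffunE mulf_eq0 (negbTE vi) (negbTE wj).
Qed.

End Tens.

Lemma tensmap_tens I J I' J' (f : 'Hom(vec k I, vec k I'))
    (g : 'Hom(vec k J, vec k J')) v w :
  tensmap f g (tens v w) = tens (f v) (g w).
Proof.
elim/vec_ind: v => [c u v fu fv||i]; last elim/vec_ind: w => [c u v fu fv||j].
- by rewrite tens_linl !hom_lin fu fv tens_linl.
- by rewrite tens0l !hom0 tens0l.
- by rewrite tens_linr !hom_lin fu fv tens_linr.
- by rewrite tens0r !hom0 tens0r.
- by rewrite tens_bv lext_bv.
Qed.

Lemma tassoc_tens I J K (u : vec k I) (v : vec k J) (w : vec k K) :
  tassoc k I J K (tens (tens u v) w) = tens u (tens v w).
Proof.
elim/vec_ind: u => [c u u' fu fv||i]; last elim/vec_ind: v => [c u v fu fv||j].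
- by rewrite !(tens_linl, tens_linr) !hom_lin fu fv.
- by rewrite !(tens0l, tens0r) !hom0.
- by rewrite !(tens_linl, tens_linr) !hom_lin fu fv.
- by rewrite !(tens0l, tens0r) !hom0.
elim/vec_ind: w => [c u v fu fv||l].
- by rewrite !(tens_linl, tens_linr) !hom_lin fu fv.
- by rewrite !(tens0l, tens0r) !hom0.
- by rewrite !tens_bv lext_bv.
Qed.

Lemma contractl_tens I J (f : 'Hom(vec k I, k^o)) (v : vec k I) (w : vec k J) :
  contractl J f (tens v w) = (f v : k) *: w.
Proof.
elim/vec_ind: v => [c u v fu fv||i]; last elim/vec_ind: w => [c u v fu fv||j].
- by rewrite !(tens_linl, tens_linr) !hom_lin fu fv scalerDl
    [in RHS]/GRing.scale /= scalerA.
- by rewrite !(tens0l, tens0r) !hom0 scale0r.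
- by rewrite !(tens_linl, tens_linr) !hom_lin fu fv scalerDr !scalerA mulrC.
- by rewrite !(tens0l, tens0r) !hom0 scaler0.
- by rewrite tens_bv lext_bv.
Qed.

Lemma contractr_tens I J (f : 'Hom(vec k J, k^o)) (v : vec k I) (w : vec k J) :
  contractr I f (tens v w) = (f w : k) *: v.
Proof.
elim/vec_ind: v => [c u v fu fv||i]; last elim/vec_ind: w => [c u v fu fv||j].
- by rewrite !(tens_linl, tens_linr) !hom_lin fu fv scalerDr !scalerA mulrC.
- by rewrite !(tens0l, tens0r) !hom0 scaler0.
- by rewrite !(tens_linl, tens_linr) !hom_lin fu fv scalerDl
    [in RHS]/GRing.scale /= scalerA.
- by rewrite !(tens0l, tens0r) !hom0 scale0r.
- by rewrite tens_bv lext_bv.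
Qed.

Definition flip I : 'End(vec k (I * I)) :=
  lext (fun p : I * I => bv k (p.2, p.1)).

Lemma flip_tens I (v w : vec k I) : flip I (tens v w) = tens w v.
Proof.
elim/vec_ind: v => [c u v fu fv||i]; last elim/vec_ind: w => [c u v fu fv||j].
- by rewrite !(tens_linl, tens_linr) !hom_lin fu fv.
- by rewrite !(tens0l, tens0r) !hom0.
- by rewrite !(tens_linl, tens_linr) !hom_lin fu fv.
- by rewrite !(tens0l, tens0r) !hom0.
- by rewrite !tens_bv lext_bv.
Qed.

Lemma sum_delta (I : finType) (F : I -> k) j : \sum_i F i * (i == j)%:R = F j.
Proof.
rewrite (bigD1 j) //= eqxx mulr1 big1 ?addr0 // => i /negbTE ->.
by rewrite mulr0.
Qed.

End VecTheory.

(** * The bismash product *)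

Section MatchedPair.
Variables (Gam L : finGroupType) (M : matched_pair Gam L).
Notation "l :<| x" := (ract M l x) (at level 40, left associativity).
Notation "l |:> x" := (lact M l x) (at level 40, left associativity).

Lemma ract1l x : 1%g :<| x = 1%g.
Proof.
apply: (mulgI (1%g :<| x)); rewrite mulg1.
by rewrite -{1}[x](lact1 M) -ract_mul mulg1.
Qed.

Lemma lact1r l : l |:> 1%g = 1%g.
Proof.
apply: (mulgI (l |:> 1%g)); rewrite mulg1.
by rewrite -{2}[l](ract1 M) -lact_mul mulg1.
Qed.

Lemma ractK x : cancel (fun l => l :<| x) (fun l => l :<| x^-1%g).
Proof. by move=> l; rewrite -ractM mulgV ract1. Qed.

Lemma ractKV x : cancel (fun l => l :<| x^-1%g) (fun l => l :<| x).
Proof. by move=> l; rewrite -ractM mulVg ract1. Qed.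

Lemma lactK l : cancel (lact M l) (lact M l^-1%g).
Proof. by move=> x; rewrite -lactM mulVg lact1. Qed.

Lemma lactKV l : cancel (lact M l^-1%g) (lact M l).
Proof. by move=> x; rewrite -lactM mulgV lact1. Qed.

Lemma ract_invl l x : l^-1%g :<| (l |:> x) = (l :<| x)^-1%g.
Proof. by apply: (mulIg (l :<| x)); rewrite -ract_mul !mulVg ract1l. Qed.

(** Together with [lact_inv], this says that sending [(l, x)] to [((l :<| x)^-1, (l |:> x)^-1)] is
    an involution. The antipode is its linear extension. *)
Lemma ract_inv l x : (l :<| x)^-1%g :<| (l |:> x)^-1%g = l^-1%g.
Proof. by rewrite -ract_invl ractK. Qed.

Lemma lact_inv l x : (l :<| x)^-1%g |:> (l |:> x)^-1%g = x^-1%g.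
Proof.
apply: (mulgI x); rewrite -{1}[x](lactK l) -ract_invl -lact_mul.
by rewrite !mulgV lact1r.
Qed.

Lemma ract_eq1 l x : (l :<| x == 1%g) = (l == 1%g).
Proof. by rewrite -{1}(ract1l x) (can_eq (ractK x)). Qed.

End MatchedPair.

(** * Algebra, coalgebra and antipode of the bismash product *)

Section BismashTheory.
Variables (k : fieldType) (Gam L : finGroupType) (M : matched_pair Gam L).
Notation "l :<| x" := (ract M l x) (at level 40, left associativity).
Notation "l |:> x" := (lact M l x) (at level 40, left associativity).
Notation H := (vec k (L * Gam)).
Notation B := (bismash k M).
Notation e := (@bvH k Gam L).

Lemma bismash_mul_bv l x t y :
  mulm B (tens (e l x) (e t y)) = if l :<| x == t then e l (x * y)%g else 0.
Proof. by rewrite tens_bv lext_bv. Qed.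

Lemma bismash_comul_bv l x : comulm B (e l x) =
  \sum_u tens (e u ((u^-1 * l)%g |:> x)) (e (u^-1 * l)%g x).
Proof. by rewrite lext_bv. Qed.

Lemma bismash_counit_bv l x : counitm B (e l x) = (l == 1%g)%:R.
Proof. by rewrite lext_bv. Qed.

Lemma bismash_mul_linl c (x x' y : H) : mulm B (tens (c *: x + x') y) =
  c *: mulm B (tens x y) + mulm B (tens x' y).
Proof. by rewrite tens_linl hom_lin. Qed.

Lemma bismash_mul_linr c (x y y' : H) : mulm B (tens x (c *: y + y')) =
  c *: mulm B (tens x y) + mulm B (tens x y').
Proof. by rewrite tens_linr hom_lin. Qed.

Definition bismash_lin := (bismash_mul_linl, bismash_mul_linr, hom_lin).
Definition bismash_lin0 := (tens0l, tens0r, hom0).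

Lemma bismash_algebra : is_algebra B.
Proof.
split.
- move=> u v w.
  elim/vec_ind: u => [c u u' IH IH'||[l x]];
    first by rewrite !bismash_lin IH IH'.
    by rewrite !bismash_lin0.
  elim/vec_ind: v => [c u u' IH IH'||[t y]];
    first by rewrite !bismash_lin IH IH'.
    by rewrite !bismash_lin0.
  elim/vec_ind: w => [c u u' IH IH'||[s z]];
    first by rewrite !bismash_lin IH IH'.
    by rewrite !bismash_lin0.
  rewrite !bismash_mul_bv; case: eqP => [<-|ne]; last first.
    by rewrite tens0l hom0; case: eqP => // _;
      rewrite ?tens0r ?hom0 // bismash_mul_bv; case: eqP.
  rewrite bismash_mul_bv ractM; case: eqP => _; last by rewrite tens0r hom0.
  by rewrite bismash_mul_bv eqxx mulgA.
- elim/vec_ind => [c u u' IH IH'||[t y]]; first by rewrite !bismash_lin IH IH'.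
    by rewrite !bismash_lin0.
  rewrite tens_suml hom_sum; under eq_bigr do rewrite bismash_mul_bv ract1.
  by rewrite -big_mkcond big_pred1_eq mul1g.
- elim/vec_ind => [c u u' IH IH'||[t y]]; first by rewrite !bismash_lin IH IH'.
    by rewrite !bismash_lin0.
  rewrite tens_sumr hom_sum; under eq_bigr do rewrite bismash_mul_bv eq_sym.
  by rewrite -big_mkcond big_pred1_eq mulg1.
Qed.

Lemma bismash_coalgebra : is_coalgebra B.
Proof.
split; elim/vec_ind => [c u u' IH IH'||[l x]].
- by rewrite !hom_lin IH IH'.
- by rewrite !hom0.
- rewrite bismash_comul_bv !hom_sum.
  under eq_bigr do rewrite tensmap_tens id_lfunE bismash_comul_bv tens_suml
    hom_sum.
  under [RHS]eq_bigr do rewrite tensmap_tens id_lfunE bismash_comul_bv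
    tens_sumr.
  (* Both sides run over the factorizations of [l] into three factors, the first two being [v] and
     [u]. On the left [u] first stands for the product of these two, whence the reindexing. *)
  rewrite exchange_big; apply: eq_bigr => v _ /=.
  rewrite (reindex_inj (mulgI v)); apply: eq_bigr => u _ /=.
  by rewrite tassoc_tens mulKg invMg -lactM -!mulgA mulKVg.
- by rewrite !hom_lin IH IH'.
- by rewrite !hom0.
- rewrite bismash_comul_bv !hom_sum (bigD1 1%g) //= big1 => [|u /negbTE u1].
    by rewrite contractl_tens bismash_counit_bv eqxx scale1r invg1 mul1g addr0.
  by rewrite contractl_tens bismash_counit_bv u1 scale0r.
- by rewrite !hom_lin IH IH'.
- by rewrite !hom0.
- rewrite bismash_comul_bv !hom_sum (bigD1 l) //= big1 => [|u ul].
    by rewrite contractr_tens bismash_counit_bv mulVg eqxx scale1r lact1 addr0.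
  by rewrite contractr_tens bismash_counit_bv -eq_mulVg1 (negbTE ul) scale0r.
Qed.

Lemma bismash_unitE : unitv B = \sum_l e l 1%g. Proof. by []. Qed.

Lemma bismash_comul1 : comulm B (unitv B) = tens (unitv B) (unitv B).
Proof.
rewrite bismash_unitE hom_sum tens_suml.
under eq_bigr do rewrite bismash_comul_bv.
rewrite exchange_big; apply: eq_bigr => u _ /=; rewrite tens_sumr.
by rewrite (reindex_inj (mulgI u)); apply: eq_bigr => l _; rewrite mulKg lact1r.
Qed.

Lemma bismash_counit1 : counitm B (unitv B) = 1.
Proof.
rewrite bismash_unitE hom_sum; under eq_bigr do rewrite bismash_counit_bv.
by rewrite (bigD1 1%g) //= eqxx big1 ?addr0 // => l /negbTE->.
Qed.

Lemma bismash_counitM x y :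
  counitm B (mulm B (tens x y)) = counitm B x * counitm B y.
Proof.
elim/vec_ind: x => [c u u' IH IH'||[l x]].
- by rewrite !bismash_lin IH IH' mulrDl /GRing.scale /= mulrA.
- by rewrite !bismash_lin0 mul0r.
elim/vec_ind: y => [c u u' IH IH'||[t y]].
- by rewrite !bismash_lin IH IH' mulrDr /GRing.scale /= mulrCA.
- by rewrite !bismash_lin0 mulr0.
rewrite bismash_mul_bv !bismash_counit_bv; case: (eqVneq l 1%g) => [->|l1].
  by rewrite ract1l mul1r eq_sym; case: eqP => _;
    rewrite ?bismash_counit_bv ?eqxx ?hom0.
by rewrite mul0r; case: eqP => _;
  rewrite ?hom0 // bismash_counit_bv (negbTE l1).
Qed.

Definition bismash_antipode : 'End(H) :=
  lext (fun p : L * Gam => e (p.1 :<| p.2)^-1%g (p.1 |:> p.2)^-1%g).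

Lemma bismash_antipode_bv l x :
  bismash_antipode (e l x) = e (l :<| x)^-1%g (l |:> x)^-1%g.
Proof. by rewrite lext_bv. Qed.

Lemma bismash_antipode_invol : involutive bismash_antipode.
Proof.
elim/vec_ind => [c u u' IH IH'||[l x]]; first by rewrite !hom_lin IH IH'.
  by rewrite !hom0.
by rewrite !bismash_antipode_bv ract_inv lact_inv !invgK.
Qed.

Lemma bismash_antipodel x :
  mulm B (tensmap bismash_antipode \1%VF (comulm B x)) =
  (counitm B x : k) *: unitv B.
Proof.
elim/vec_ind: x => [c u u' IH IH'||[l x]].
- by rewrite !hom_lin IH IH' scalerDl [in RHS]/GRing.scale /= scalerA.
- by rewrite !hom0 scale0r.
rewrite bismash_comul_bv bismash_counit_bv !hom_sum.
(* The two factors are composable exactly when [u^-1 = u^-1 * l], so all terms vanish unless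
   [l = 1]. *)
have E u : mulm B (tensmap bismash_antipode \1%VF
    (tens (e u ((u^-1 * l)%g |:> x)) (e (u^-1 * l)%g x))) =
    (l == 1%g)%:R *: e (u^-1 :<| x)%g 1%g.
  rewrite tensmap_tens id_lfunE bismash_antipode_bv bismash_mul_bv ract_inv.
  rewrite -lactM mulKVg -{1}[(u^-1)%g]mulg1 (inj_eq (mulgI _)) eq_sym.
  case: eqP => [->|_]; last by rewrite scale0r.
  rewrite scale1r lact1 mulVg mulg1; congr e.
  by rewrite -ract_invl lactKV.
under eq_bigr do rewrite E; rewrite -scaler_sumr; congr (_ *: _).
(* As [u] runs over [L], so does [u^-1 :<| x], and the sum is the unit. *)
rewrite (reindex_inj invg_inj) (reindex_inj (can_inj (ractKV M x))) /=.
by apply: eq_bigr => u _; rewrite invgK ractKV.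
Qed.

Lemma bismash_antipoder x :
  mulm B (tensmap \1%VF bismash_antipode (comulm B x)) =
  (counitm B x : k) *: unitv B.
Proof.
elim/vec_ind: x => [c u u' IH IH'||[l x]].
- by rewrite !hom_lin IH IH' scalerDl [in RHS]/GRing.scale /= scalerA.
- by rewrite !hom0 scale0r.
rewrite bismash_comul_bv bismash_counit_bv !hom_sum scaler_sumr.
apply: eq_bigr => u _.
(* Here composability says that a product of two elements of [L] is 1, and by [ract_mul] that
   product is [l :<| x]. *)
rewrite tensmap_tens id_lfunE bismash_antipode_bv bismash_mul_bv mulgV.
rewrite eq_mulgV1 invgK -ract_mul mulKVg ract_eq1.
by case: eqP; rewrite ?scale1r ?scale0r.
Qed.

(** * Coordinates of the structure maps and uniqueness of the braiding *)

Lemma bismash_mul_coordl (p q : L * Gam) a b :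
  mulm B (bv k (p, q)) (a, b) =
  (p.1 == a)%:R * (q == (a :<| p.2, p.2^-1 * b)%g)%:R :> k.
Proof.
case: p q => [l x] [t y] /=; rewrite -tens_bv bismash_mul_bv.
rewrite -natrM mulnb xpair_eqE.
case: (eqVneq (l :<| x) t) => [<-|lt]; rewrite ?ffunE ?xpair_eqE.
  rewrite (can_eq (ractK M x)) [a == l]eq_sym; case: eqP => // _ /=.
  by rewrite -(inj_eq (mulgI x) y) mulKVg eq_sym.
by case: eqP => [<-|//] /=; rewrite eq_sym (negbTE lt).
Qed.

Lemma bismash_mul_coordr (p q : L * Gam) a b :
  mulm B (bv k (p, q)) (a, b) =
  (p == (a, b * q.2^-1)%g)%:R * (q.1 == a :<| (b * q.2^-1)%g)%:R :> k.
Proof.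
case: p q => [l x] [t y] /=; rewrite -tens_bv bismash_mul_bv.
rewrite -natrM mulnb xpair_eqE -(inj_eq (mulIg y) x) mulgKV.
case: (eqVneq (l :<| x) t) => [<-|lt]; rewrite ?ffunE ?xpair_eqE.
  rewrite [a == l]eq_sym [b == _]eq_sym; case: eqP => //= ->.
  by case: eqP => //= <-; rewrite mulgK eqxx.
by case: eqP => //= <-; case: eqP => //= <-; rewrite mulgK eq_sym (negbTE lt).
Qed.

Lemma bvHE (l : L) (x : Gam) p : e l x p = (p == (l, x))%:R :> k.
Proof. exact: bvE. Qed.

Lemma bvH_neq0 (l : L) (x : Gam) : e l x != 0.
Proof. exact: bv_neq0. Qed.

Lemma bvH_inj (l l' : L) (x x' : Gam) : e l x = e l' x' -> (l, x) = (l', x').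
Proof.
move=> E; have := @scale_bv_inj k _ 1 1 (l, x) (l', x') (oner_neq0 _).
by rewrite !scale1r => /(_ E) [].
Qed.

Lemma bismash_mulE (x y : H) l g : mulm B (tens x y) (l, g) =
  \sum_h (x (l, h) : k) * y (l :<| h, h^-1 * g)%g.
Proof.
elim/vec_ind: x => [c u u' IH IH'||p].
- rewrite tens_linl hom_lin vec_linE IH IH' mulr_sumr -big_split.
  by apply: eq_bigr => h _; rewrite vec_linE mulrDl -mulrA.
- by rewrite tens0l hom0 ffunE big1 // => h _; rewrite ffunE mul0r.
elim/vec_ind: y => [c u u' IH IH'||q].
- rewrite tens_linr hom_lin vec_linE IH IH' mulr_sumr -big_split.
  by apply: eq_bigr => h _; rewrite vec_linE mulrDr [in RHS]mulrCA.
- by rewrite tens0r hom0 ffunE big1 // => h _; rewrite [X in _ * X]ffunE mulr0.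
rewrite tens_bv bismash_mul_coordl.
under eq_bigr do rewrite !bvE mulrC.
case: p => l0 x0; rewrite (bigD1 x0) //= big1 => [|h hx]; last first.
  by rewrite xpair_eqE (negbTE hx) andbF mulr0.
by rewrite /= addr0 xpair_eqE eqxx andbT mulrC [l0 == l]eq_sym [q == _]eq_sym.
Qed.

Lemma bismash_comulE (v : H) u h w g :
  comulm B v ((u, h), (w, g)) = (h == w |:> g)%:R * v (u * w, g)%g :> k.
Proof.
elim/vec_ind: v => [c x y IH IH'||[l x]].
- by rewrite hom_lin !vec_linE IH IH' mulrDr [in RHS]mulrCA.
- by rewrite hom0 !ffunE mulr0.
rewrite bismash_comul_bv sum_ffunE (bigD1 u) //= big1 => [|s su]; last first.
  by rewrite tensE !bvHE /= xpair_eqE eq_sym (negbTE su) mul0r.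
rewrite addr0 tensE !bvHE !xpair_eqE /= eqxx /= -!natrM !mulnb.
congr (_%:R); congr nat_of_bool.
rewrite -[w == _](inj_eq (mulgI u)) mulKVg.
case: ((u * w)%g =P l) => [<-|_]; last by rewrite !andbF.
by rewrite mulKg; case: (g =P x) => [->|_]; rewrite ?andbF.
Qed.

(** The sums over [v], [w] from the two coproducts and over the two components [q1], [q2] of the
    output of [c] all collapse. The coordinates [(a, b)] of the left slot determine [v] and [q1],
    and the coordinates [(s, d)] of the right slot determine [q2] and [w]. *)
Lemma midmap_coord (c : 'End(vec k ((L * Gam) * (L * Gam)))) l x t y a b s d :
  let u := ((a^-1 * l)%g |:> x) in let r := (s :<| (d * y^-1)%g) in
  tensmap (mulm B) (mulm B)
    (midmap c (tens (comulm B (e l x)) (comulm B (e t y)))) ((a, b), (s, d)) =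
  c (bv k (((a^-1 * l)%g, x), ((t * r^-1)%g, r |:> y)))
    ((a :<| u, (u^-1 * b)%g), (s, (d * y^-1)%g)).
Proof.
move=> u r; rewrite !bismash_comul_bv tens_suml !hom_sum sum_ffunE.
pose U v := ((v^-1 * l)%g |:> x); pose W w := ((w^-1 * t)%g |:> y).
pose C v w := c (bv k (((v^-1 * l)%g, x), (w, W w))).
transitivity (\sum_v \sum_w \sum_(q1 : L * Gam) \sum_(q2 : L * Gam)
    C v w (q1, q2) * ((v == a)%:R * (q1 == (a :<| U v, (U v)^-1 * b)%g)%:R) *
    ((q2 == (s, d * y^-1)%g)%:R * (w == (t * r^-1)%g)%:R) : k).
  apply: eq_bigr => v _; rewrite tens_sumr !hom_sum sum_ffunE.
  apply: eq_bigr => w _; rewrite pair_big /= !tens_bv lext_bv hom_sum sum_ffunE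
    /=.
  apply: eq_bigr => -[q1 q2] _ /=.
  rewrite linearZ ffunE /= lext_bv tensE /= bismash_mul_coordl
    bismash_mul_coordr /=.
  rewrite [_ *: _]mulrA; congr (_ * (_ * _%:R)).
  by rewrite -/r -(inj_eq (mulgI w)) mulKVg -(inj_eq (mulIg r^-1%g)) mulgK
    eq_sym.
transitivity (\sum_v (\sum_w (C v w
  ((a :<| U v, (U v)^-1 * b)%g, (s, d * y^-1)%g))
    * (w == (t * r^-1)%g)%:R) * (v == a)%:R).
  apply: eq_bigr => v _; rewrite mulr_suml; apply: eq_bigr => w _.
  pose F q1 q2 := C v w (q1, q2) * (w == (t * r^-1)%g)%:R * (v == a)%:R.
  rewrite -/(F _ _) -[RHS](sum_delta (F^~ _)); apply: eq_bigr => q1 _.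
  rewrite -[F q1 _](sum_delta (F q1)) mulr_suml; apply: eq_bigr => q2 _.
  rewrite /F -!mulrA; congr (_ * _).
  rewrite [RHS]mulrCA; congr (_ * _); rewrite [LHS]mulrCA [RHS]mulrCA.
  by congr (_ * _); rewrite mulrC.
rewrite sum_delta sum_delta /C /W invMg invgK mulgKV.
by [].
Qed.

Lemma bismash_comulM x y : comulm B (mulm B (tens x y)) =
  tensmap (mulm B) (mulm B) (midmap (flip k _)
    (tens (comulm B x) (comulm B y))).
Proof.
elim/vec_ind: x => [c u u' IH IH'||[l x]].
- by rewrite tens_linl !hom_lin IH IH' tens_linl !hom_lin.
- by rewrite !bismash_lin0.
elim/vec_ind: y => [c u u' IH IH'||[t y]].
- by rewrite tens_linr !hom_lin IH IH' tens_linr !hom_lin.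
- by rewrite !bismash_lin0.
apply/ffunP => -[[a b] [s d]]; rewrite midmap_coord /= lext_bv bvE /=.
rewrite !xpair_eqE bismash_mul_bv.
(* Both sides are indicators of the same four conditions; under [l = a * s] and [d = x * y] the
   remaining two match by the matched pair identities. *)
transitivity (((l :<| x == t) &&
  [&& b == s |:> d, l == (a * s)%g & d == (x * y)%g])%:R : k).
  case: (l :<| x == t) => /=; last by rewrite hom0 ffunE.
  rewrite bismash_comul_bv sum_ffunE (bigD1 a) //= big1 => [|u ua]; last first.
    by rewrite !ffunE !xpair_eqE /= eq_sym (negbTE ua) mul0r.
  rewrite addr0 !ffunE !xpair_eqE /= eqxx /= -natrM mulnb; congr (_%:R).
  rewrite -(inj_eq (mulgI a)) mulKVg [(a * s)%g == l]eq_sym.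
  case: (l =P (a * s)%g) => [->|_] /=; last by rewrite !andbF.
  by rewrite mulKg; case: (d =P (x * y)%g) => [->|]; rewrite ?andbF.
congr ((nat_of_bool _)%:R).
have -> : ((d * y^-1)%g == x) = (d == (x * y)%g).
  by rewrite -(inj_eq (mulIg y)) mulgKV.
have -> : (s == (a^-1 * l)%g) = (l == (a * s)%g).
  by rewrite -(inj_eq (mulgI a)) mulKVg eq_sym.
case: (d =P (x * y)%g) => [->|_]; last by rewrite !andbF.
case: (l =P (a * s)%g) => [->|_]; last by rewrite !andbF.
rewrite !andbT mulKg mulgK ract_mul lact_mul; congr (_ && _).
  by rewrite -[RHS](inj_eq (mulIg (s :<| x))) mulgKV.
by rewrite -[RHS](inj_eq (mulgI (s |:> x))) mulKVg.
Qed.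

(** By [midmap_coord] every entry of [c] is a coordinate of the coproduct of a product of basis
    elements, so [c] and the flip agree entry by entry. *)
Lemma braiding_unique (c : 'End(vec k ((L * Gam) * (L * Gam)))) :
    (forall x y, comulm B (mulm B (tens x y)) =
      tensmap (mulm B) (mulm B) (midmap c (tens (comulm B x) (comulm B y)))) ->
  c = flip k _.
Proof.
move=> cM; apply: hom_bv_ext => -[[v x] [s z]].
apply/ffunP => -[[p1 x1] [p2 x2]].
(* These values solve the equations of [midmap_coord] for a prescribed entry of [c]; the actions are
   invertible, so a solution always exists. *)
pose r := p2 :<| x2; pose y := (r^-1%g |:> z); pose u := (v |:> x).
pose a := (p1 :<| u^-1)%g.
have := cM (e (a * v)%g x) (e (s * r)%g y); rewrite bismash_comulM.
move/ffunP/(_ ((a, (u * x1)%g), (p2, (x2 * y)%g))); rewrite !midmap_coord.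
by rewrite !mulKg !mulgK lactKV ractKV.
Qed.

End BismashTheory.

(** * Data of the automorphisms of the extension *)

Section ExtData.
Variables (k : fieldType) (Gam L : finGroupType) (M : matched_pair Gam L).
Notation "l :<| x" := (ract M l x) (at level 40, left associativity).
Notation "l |:> x" := (lact M l x) (at level 40, left associativity).
Notation H := (vec k (L * Gam)).
Notation B := (bismash k M).
Notation e := (@bvH k Gam L).

(** The projection [p] onto the coordinates [(t, 1)] fixes the generators of the span, hence the
    whole span. *)
Lemma fun_spaceE (v : H) : v \in fun_space k Gam L ->
  forall t x, v (t, x) = (x == 1%g)%:R * v (t, 1%g) :> k.
Proof.
pose p : 'End(H) := lext (fun q : L * Gam => if q.2 == 1%g then bv k q else 0).
have sub : (fun_space k Gam L <= fixedSpace p)%VS.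
  apply/span_subvP => _ /imageP[l _ ->]; apply/fixedSpaceP.
  by rewrite lext_bv eqxx.
move=> /(subvP sub)/fixedSpaceP <- t x; rewrite lextE !sum_ffunE.
case: eqP => [->|/eqP x1]; first by rewrite mul1r.
rewrite mul0r big1 // => -[s y] _ /=; rewrite ffunE.
case: ifP => [/eqP->|_]; last by rewrite ffunE [_ *: _]mulr0.
by rewrite bvE xpair_eqE (negbTE x1) andbF [_ *: _]mulr0.
Qed.

Section Existence.
Variable f : 'End(H).
Hypothesis fP : is_ext_aut M f.

Let fI : injective f. Proof. by case: fP => -[] /bij_inj. Qed.
Let fM x y : f (mulm B (tens x y)) = mulm B (tens (f x) (f y)).
Proof. by case: fP => -[]. Qed.
Let fD x : comulm B (f x) = tensmap f f (comulm B x).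
Proof. by case: fP => -[]. Qed.

Lemma ext_aut_neq0 l x : exists p, f (e l x) p != 0.
Proof. by apply: vec_neq0P; rewrite -(hom0 f) (inj_eq fI) bvH_neq0. Qed.

(** The automorphism permutes the primitive idempotents [e l 1]. For fixed [t] the coefficients
    [a l t] are orthogonal idempotents of [k] with sum 1, so exactly one of them, at [l = h t], is
    1. *)
Lemma ext_aut_delta : exists2 s : {perm L}, s \in Aut [set: L] &
  forall l, f (e l 1%g) = e (s l) 1%g.
Proof.
pose a l t : k := f (e l 1%g) (t, 1%g).
have aE l t x : f (e l 1%g) (t, x) = (x == 1%g)%:R * a l t :> k.
  apply: fun_spaceE; case: fP => _ /subvP; apply; apply: memv_img.
  by apply: memv_span; apply/imageP; exists l.
have aM l l' t : a l t * a l' t = (l == l')%:R * a l t.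
  have := congr1 (fun v : H => v (t, 1%g)) (fM (e l 1%g) (e l' 1%g)).
  rewrite bismash_mulE bismash_mul_bv ract1 mulg1 (bigD1 1%g) //= big1 =>
    [|h h1]; last first.
    by rewrite aE (negbTE h1) !mul0r.
  rewrite addr0 ract1 invg1 mulg1 => <-.
  by case: eqP => _; rewrite ?mul1r // hom0 ffunE mul0r.
have aS t : \sum_l a l t = 1.
  have := congr1 (fun v : H => v (t, 1%g)) (haut_unit (proj1 fP)).
  rewrite bismash_unitE hom_sum !sum_ffunE => ->.
  rewrite (bigD1 t) //= bvHE eqxx big1 ?addr0 // => s ts.
  by rewrite bvHE xpair_eqE eq_sym (negbTE ts).
have ex_h t : exists l, a l t != 0.
  apply/existsP; have := oner_neq0 k; rewrite -(aS t).
  apply: contraNT => /existsPn a0; rewrite big1 // => l _.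
  by apply/eqP; rewrite -[_ == _]negbK a0.
pose h t := xchoose (ex_h t).
have hE l t : a l t = (h t == l)%:R.
  have aht := xchooseP (ex_h t); rewrite -/(h t) in aht.
  case: eqP => [<-|/eqP hl].
    by apply: (mulfI aht); rewrite aM eqxx mul1r mulr1.
  by apply: (mulfI aht); rewrite aM (negbTE hl) mul0r mulr0.
(* Injectivity of [f] makes [h] surjective, and a section of it is injective, hence a permutation of
   the finite set [L]. *)
have ex_g l : exists t, h t == l.
  have [[t x]] := ext_aut_neq0 l 1%g; rewrite aE hE => tx; exists t.
  by move: tx; case: (h t == l) => //; rewrite mulr0 eqxx.
pose g l := xchoose (ex_g l).
have gK : cancel g h by move=> l; apply/eqP/(xchooseP (ex_g l)).
pose s := perm (can_inj gK).
have hs l : h (s l) = l by rewrite permE gK.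
have hK t : s (h t) = t by rewrite -{1}(permKV s t) hs permKV.
have fE l : f (e l 1%g) = e (s l) 1%g.
  apply/ffunP => -[t x]; rewrite aE hE bvHE xpair_eqE -natrM mulnb andbC.
  by rewrite -[h t == l](inj_eq (@perm_inj _ s)) hK.
exists s => //; rewrite inE; apply/andP; split.
  by apply/subsetP => x; rewrite inE.
apply/morphicP => u w _ _; apply/esym/eqP.
(* Computed from the coproduct of [e (u * w) 1], this coordinate is 1; it can be nonzero in the
   coproduct of the image only if [s] is multiplicative at [u], [w]. *)
have := congr1 (fun v : vec k ((L * Gam) * (L * Gam)) =>
  v ((s u, 1%g), (s w, 1%g)))
  (fD (e (u * w)%g 1%g)).
rewrite bismash_comulE fE lact1r eqxx mul1r bvHE xpair_eqE eqxx andbT.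
rewrite bismash_comul_bv hom_sum sum_ffunE (bigD1 u) //= big1 => [|v vu];
  last first.
  rewrite tensmap_tens lact1r !fE tensE !bvHE !xpair_eqE (inj_eq perm_inj).
  by rewrite eq_sym (negbTE vu) mul0r.
rewrite addr0 tensmap_tens lact1r !fE tensE !bvHE mulKg !eqxx mulr1.
by case: eqP => // _ /eqP; rewrite eq_sym oner_eq0.
Qed.

(** Since [e l x] is the product of [e l 1] and [e l x], its image lives on the coordinates
    [(s l, y)]. Comultiplicativity makes the coefficients for [l = 1] orthogonal idempotents again,
    which selects one [y = F x], and the same [y] serves for every [l]. *)
Lemma ext_data_exists : exists d, ext_data_of f d.
Proof.
have [s sA sE] := ext_aut_delta.
have s1 : s 1%g = 1%g.
  have /morphicP sM : morphic [set: L] s by case/setIdP: sA.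
  by apply: (mulgI (s 1%g)); rewrite -sM ?inE // !mulg1.
have supp l x t y : f (e l x) (t, y) = (t == s l)%:R * f (e l x) (s l, y) :> k.
  have := congr1 (fun v : H => v (t, y)) (fM (e l 1%g) (e l x)).
  rewrite sE bismash_mulE bismash_mul_bv ract1 eqxx mul1g (bigD1 1%g) //=
    big1 => [|h h1]; last first.
    by rewrite bvHE xpair_eqE (negbTE h1) andbF mul0r.
  rewrite addr0 ract1 invg1 mul1g bvHE xpair_eqE eqxx andbT => ->.
  by case: eqP => [->|_]; rewrite ?mul1r ?mul0r.
pose c l x y : k := f (e l x) (s l, y).
(* Only the term of the coproduct for [l = l * 1] contributes to this coordinate. *)
have cM l x y y' : c l x y' * c 1%g x y = (y' == y)%:R * c l x y.
  have := congr1 (fun v : vec k ((L * Gam) * (L * Gam)) =>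
    v ((s l, y'), (1%g, y)))
    (fD (e l x)).
  rewrite bismash_comulE lact1 mulg1 -/(c l x y) => ->.
  rewrite bismash_comul_bv hom_sum sum_ffunE (bigD1 l) //= big1 => [|v vl];
    last first.
    rewrite tensmap_tens tensE /= supp (inj_eq perm_inj) eq_sym (negbTE vl).
    by rewrite !mul0r.
  by rewrite addr0 tensmap_tens tensE /= mulVg lact1 /c s1.
have ex_F x : exists y, c 1%g x y != 0.
  have [[t y]] := ext_aut_neq0 1%g x; rewrite supp => cx; exists y.
  by apply: contraNneq cx => cx; rewrite -/(c 1%g x y) cx mulr0.
pose F x := xchoose (ex_F x).
have F1 x : c 1%g x (F x) = 1.
  by apply: (mulfI (xchooseP (ex_F x))); rewrite -/(F x) cM eqxx mul1r mulr1.
have cE l x y : c l x y = (y == F x)%:R * c l x (F x).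
  by rewrite -cM F1 mulr1.
have fE l x : f (e l x) = c l x (F x) *: e (s l) (F x).
  apply/ffunP => -[t y]; rewrite supp -/(c l x y) cE !ffunE xpair_eqE.
  by rewrite /GRing.scale /= -mulnb natrM mulrA mulrC.
have f1 x : f (e 1%g x) = e 1%g (F x) by rewrite fE F1 scale1r s1.
have FI : injective F.
  by move=> x x' xx'; have /fI/bvH_inj[] : f (e 1%g x) = f (e 1%g x')
    by rewrite !f1 xx'.
(* The scalars are indexed by the image point in [L], hence the inverse of [s]. *)
exists (ExtData s (perm FI) (fun x t => c (s^-1%g t) x (F x))); split => //=.
- rewrite inE; apply/andP; split; first by apply/subsetP => x; rewrite inE.
  apply/morphicP => x x' _ _; rewrite !permE.
  have := fM (e 1%g x) (e 1%g x').
  by rewrite !f1 !bismash_mul_bv !ract1l eqxx f1 => /bvH_inj[].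
- move=> x l; have [[t y]] := ext_aut_neq0 (s^-1%g l) x;
    apply: contraNneq => c0.
  by rewrite fE c0 scale0r ffunE.
- by move=> l x; rewrite permK permE fE.
Qed.

End Existence.

(** * Compatibility of the data with the actions, and the antipode *)

Section Relations.
Variables (f : 'End(H)) (d : ext_data k Gam L).
Hypotheses (fP : is_ext_aut M f) (fd : ext_data_of f d).
Notation s := (ext1 d).
Notation F := (ext2 d).
Notation a := (ext_scal d).

Lemma ext1M : {morph s : l t / (l * t)%g}.
Proof.
by move=> l t; case/setIdP: (ext1_aut fd) => _ /morphicP; apply; rewrite inE.
Qed.

Lemma ext2M : {morph F : l t / (l * t)%g}.
Proof.
by move=> l t; case/setIdP: (ext2_aut fd) => _ /morphicP; apply; rewrite inE.
Qed.

Lemma ext1_1 : s 1%g = 1%g.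
Proof. by apply: (mulgI (s 1%g)); rewrite -ext1M !mulg1. Qed.

Lemma ext2_1 : F 1%g = 1%g.
Proof. by apply: (mulgI (F 1%g)); rewrite -ext2M !mulg1. Qed.

Lemma ext1V l : s l^-1%g = (s l)^-1%g.
Proof. by apply: (mulgI (s l)); rewrite -ext1M !mulgV ext1_1. Qed.

Lemma ext2V l : F l^-1%g = (F l)^-1%g.
Proof. by apply: (mulgI (F l)); rewrite -ext2M !mulgV ext2_1. Qed.

(** The product of [e l x] and [e (l :<| x) y] is nonzero, so the images are composable, which gives
    the first identity. Comparing scalars gives the second. *)
Lemma ext_mul l x y : s (l :<| x) = s l :<| F x /\
  a (x * y)%g (s l) = a x (s l) * a y (s (l :<| x)).
Proof.
have := haut_mul (proj1 fP) (e l x) (e (l :<| x) y).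
rewrite bismash_mul_bv eqxx !(ext_dataE fd) tensZl tensZr !homZ bismash_mul_bv.
rewrite scalerA; case: eqP => [<-|_].
  by move/(scale_bv_inj (ext_scal_neq0 fd _ _)) => -[].
move/eqP; rewrite scaler0 scaler_eq0 (negbTE (ext_scal_neq0 fd _ _)) /=.
by rewrite (negbTE (bvH_neq0 _ _ _)).
Qed.

Lemma ext_comul l t x : F (t |:> x) = s t |:> F x /\
  a x (s (l * t)%g) = a (t |:> x) (s l) * a x (s t).
Proof.
have := congr1 (fun v : vec k ((L * Gam) * (L * Gam)) =>
  v ((s l, F (t |:> x)), (s t, F x))) (haut_comul (proj1 fP) (e (l * t)%g x)).
rewrite bismash_comulE bismash_comul_bv hom_sum sum_ffunE (bigD1 l) //= big1 =>
  [|v vl]; last first.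
  rewrite tensmap_tens tensE !(ext_dataE fd) !ffunE /= xpair_eqE
    (inj_eq perm_inj).
  by rewrite eq_sym (negbTE vl) [_ *: 0]mulr0 mul0r.
rewrite addr0 tensmap_tens tensE mulKg !(ext_dataE fd) !ffunE /= !eqxx.
rewrite ext1M eqxx /GRing.scale /= !mulr1.
case: eqP => [->|_]; first by rewrite mul1r.
move/eqP; rewrite mul0r eq_sym mulf_eq0.
by rewrite !(negbTE (ext_scal_neq0 fd _ _)).
Qed.

Lemma ext_scal1 l : a 1%g l = 1.
Proof.
have [_] := ext_mul (s^-1%g l) 1%g 1%g; rewrite mulg1 ract1 permKV => E.
by apply: (mulfI (ext_scal_neq0 fd 1%g l)); rewrite -E mulr1.
Qed.

Lemma ext_scal_1 x : a x 1%g = 1.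
Proof.
have [_] := ext_comul 1%g 1%g x; rewrite mulg1 lact1 ext1_1 => E.
by apply: (mulfI (ext_scal_neq0 fd x 1%g)); rewrite -E mulr1.
Qed.

Lemma ext_antipode v : f (bismash_antipode k M v) = bismash_antipode k M (f v).
Proof.
elim/vec_ind: v => [c u u' IH IH'||[l x]]; first by rewrite !hom_lin IH IH'.
  by rewrite !hom0.
rewrite bismash_antipode_bv !(ext_dataE fd) homZ bismash_antipode_bv.
rewrite ext1V ext2V (proj1 (ext_mul l x 1%g)) (proj1 (ext_comul 1%g l x)).
congr (_ *: _).
(* The two scalars to be compared are both inverse to [a (l |:> x) (s l^-1)]: [E1] shows this for
   one and [E2] for the other. *)
have [_] := ext_comul l^-1%g l x; rewrite mulVg ext1_1 ext_scal_1 => E1.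
have [_] := ext_mul l^-1%g (l |:> x) (l |:> x)^-1%g.
rewrite mulgV ext_scal1 ract_invl (ext1V (l :<| x)) (proj1 (ext_mul l x 1%g)) =>
  E2.
apply: (mulfI (ext_scal_neq0 fd (l |:> x) (s l^-1%g))).
by rewrite -E2 E1.
Qed.

End Relations.

End ExtData.

(** * Support of the grading *)

Section Main.
Variables (k : closedFieldType) (char_k : [pchar k] =i pred0).
Variables (G : finGroupType) (Gam L : finGroupType) (M : matched_pair Gam L).
Variable rho : char k G -> 'End(vec k (L * Gam)).
Hypothesis rho_hom : is_rho_hom M rho.
Notation H := (vec k (L * Gam)).
Notation B := (bismash k M).
Notation e := (@bvH k Gam L).
Notation gr := (induced_gr rho).
Notation X := (char k G).

Lemma rhoM (a b : X) v : rho (a * b)%g v = rho a (rho b v).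
Proof. by rewrite -comp_lfunE -rho_hom.2. Qed.

(** The image of the trivial character is idempotent and injective. *)
Lemma rho1 v : rho 1%g v = v.
Proof.
have [[/bij_inj inj _ _ _ _] _] := rho_hom.1 1%g.
by apply: inj; rewrite -rhoM mulg1.
Qed.

Section Support.
Variable D : X -> ext_data k Gam L.
Hypothesis DP : forall a, ext_data_of (rho a) (D a).

Lemma ext_rho a l x : rho a (e l x) =
  ext_scal (D a) x (ext1 (D a) l) *: e (ext1 (D a) l) (ext2 (D a) x).
Proof. exact: ext_dataE. Qed.

Lemma ext_rhoM (a b : X) l x :
  [/\ ext1 (D (a * b)%g) l = ext1 (D a) (ext1 (D b) l),
      ext2 (D (a * b)%g) x = ext2 (D a) (ext2 (D b) x) &
      ext_scal (D (a * b)%g) x (ext1 (D (a * b)%g) l) =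
      ext_scal (D b) x (ext1 (D b) l) *
      ext_scal (D a) (ext2 (D b) x) (ext1 (D a) (ext1 (D b) l))].
Proof.
have := rhoM a b (e l x); rewrite !ext_rho homZ ext_rho scalerA.
by move/(scale_bv_inj (ext_scal_neq0 (DP _) _ _)) => [[-> ->] ->].
Qed.

(** [stabA] as a finite set, so that it can be given the structure of a subgroup. *)
Definition stab l x : {set X} :=
  [set a | (ext1 (D a) l == l) && (ext2 (D a) x == x)].

Lemma stabP l x a : reflect (stabA D l x a) (a \in stab l x).
Proof. by rewrite inE; apply: (iffP andP) => -[/eqP? /eqP?]. Qed.

Fact stab_group_set l x : group_set (stab l x).
Proof.
apply/group_setP; split=> [|a b /stabP[al ax] /stabP[bl bx]]; apply/stabP;
  split.
- by have [] := ext_rhoM 1%g 1%g l x; rewrite mulg1 => /perm_inj.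
- by have [_] := ext_rhoM 1%g 1%g l x; rewrite mulg1 => /perm_inj.
- by have [-> _ _] := ext_rhoM a b l x; rewrite bl.
- by have [_ -> _] := ext_rhoM a b l x; rewrite bx.
Qed.
Canonical stab_group l x := Group (stab_group_set l x).

Lemma phi_morph l x : {in stab l x &,
  {morph phi_lx D l x : a b / (a * b)%g >-> a * b}}.
Proof.
move=> a b Na Nb; have := groupM Na Nb.
move: Na Nb => /stabP[al ax] /stabP[bl bx] /stabP[abl _].
by have [_ _] := ext_rhoM a b l x; rewrite abl bl al bx mulrC.
Qed.

(* These are the degrees occurring in the orbit of [e l x]. *)
Definition local_degree l x (g : G) :=
  forall a, a \in stab l x -> a g = phi_lx D l x a.

(** The sum of [(a g)^-1 *: rho a (e l x)] over all [a] has degree [g]. Only the [a] in the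
    stabilizer contribute to its coordinate [(l, x)], each by 1, so this coordinate is the order of
    the stabilizer, which is nonzero in characteristic 0. *)
Lemma local_degree_support l x g : local_degree l x g -> graded_support gr g.
Proof.
move=> Sg; pose v := \sum_(a : X) (a g)^-1 *: rho a (e l x).
exists v.
  move=> b; rewrite hom_sum scaler_sumr [RHS](reindex_inj (mulgI b)).
  apply: eq_bigr => a _; rewrite homZ rhoM scalerA charMl invfM mulVKf //.
  exact: char_neq0.
have : v (l, x) != 0.
  rewrite sum_ffunE (eq_bigr (fun a => if a \in stab l x then 1 else 0)) =>
    [|a _].
    rewrite -big_mkcond sumr_const (pcharf0P _).1 // -lt0n.
    exact: cardG_gt0.
  rewrite ext_rho !ffunE xpair_eqE [l == _]eq_sym [x == _]eq_sym.
  case: ifPn => aN; last first.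
    by move: aN; rewrite inE => /negbTE ->;
      rewrite [X in _ *: X]mulr0 [_ *: _]mulr0.
  move/stabP: (aN) => [al ax]; rewrite al ax !eqxx Sg // /GRing.scale /= mulr1
    mulVf //.
  exact: ext_scal_neq0 (DP _) _ _.
by apply: contraNneq => ->; rewrite ffunE.
Qed.

(** Take a nonzero coordinate [(l, x)] of a vector of degree [g]. An [a] in the stabilizer permutes
    the basis lines and fixes this one, so it scales the coordinate by [phi_lx D l x a], while
    homogeneity gives the factor [a g]. *)
Lemma support_local_degree g :
  graded_support gr g -> exists l x, local_degree l x g.
Proof.
case=> v vg /vec_neq0P[[l x] vlx].
exists l, x => a /stabP[al ax]; apply: (mulIf vlx).
have <- : rho a v (l, x) = a g * v (l, x) :> k by rewrite vg ffunE.
rewrite [in LHS](vec_bvE v) hom_sum sum_ffunE (bigD1 (l, x)) //= big1 =>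
  [|[t y] ty].
  by rewrite addr0 homZ ext_rho al ax !ffunE eqxx /GRing.scale /= mulr1 mulrC.
rewrite homZ ext_rho !ffunE; case: eqP => [E|_]; last first.
  by rewrite [X in _ *: X]mulr0 [_ *: _]mulr0.
case: E => lt xy; case/eqP: ty; congr (_, _).
  by apply: (@perm_inj _ (ext1 (D a))); rewrite -lt al.
by apply: (@perm_inj _ (ext2 (D a))); rewrite -xy ax.
Qed.

(** * The color matched pair conditions and the support *)

Section Conditions.
Variable beta : bichar k G.

Fact chil_subproof (h : G) : is_char [ffun g => beta h g].
Proof.
by apply: is_charP => *; rewrite !ffunE ?bichar_neq0 // bichar_mulr.
Qed.
(** Pairing with [h] on the left, whereas [chi] pairs on the right. *)
Definition chil h : X := Char (chil_subproof h).

Lemma chilE h g : chil h g = beta h g. Proof. by rewrite ffunE. Qed.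

Lemma chilM : {morph chil : g h / (g * h)%g}.
Proof.
by move=> g h; apply: char_eqP => x; rewrite charMl !chilE bichar_mull.
Qed.

Lemma chiE h g : chi beta h g = beta g h. Proof. by rewrite ffunE. Qed.

(** A local degree [h] at [(u, y)] makes [chil h] a point of [rho_preim] there. Condition (2)
    provides such a point inside [stab l x], condition (1) puts the quotient of the two in
    [stab l x], and condition (3) then gives [phi] the value 1 at [chil h]; this value is
    [beta h g]. *)
Lemma conditions_support : color_conditions beta D ->
  forall g h, graded_support gr g -> graded_support gr h -> beta g h = 1.
Proof.
move=> [c1 c2 c3] h g /support_local_degree[u [y Sh]]
  /support_local_degree[l [x Sg]].
have ch : rho_preim beta D u y (chil h).
  by move=> z /stabP z_u; rewrite chilE -chiE Sh.
have [a [Na ra]] := c2 u l y x.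
have Nb : (chil h * a^-1)%g \in stab l x.
  apply/stabP/(c1 u l y) => z z_u; rewrite charMl charVl (ch z z_u) (ra z z_u)
    mulfV //.
  exact: ext_scal_neq0 (DP _) _ _.
have Nh : chil h \in stab l x.
  by rewrite -(groupMr _ (groupVr (introT (stabP _ _ _) Na))).
rewrite -chilE Sg // /phi_lx; apply: c3 ch; exact/stabP.
Qed.

Lemma local_degree_exists l x : exists g, local_degree l x g.
Proof.
have [||g gP] := @subgroup_char_eval k G char_k (stab_group l x) (phi_lx D l x).
- by move=> a _; apply: ext_scal_neq0 (DP _) _ _.
- exact: phi_morph.
by exists g.
Qed.

Definition perp l x : {set G} :=
  [set g | [forall a in stab l x, (a : X) g == 1]].

Lemma perpP l x g : reflect {in stab l x, forall a : X, a g = 1}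
  (g \in perp l x).
Proof. by rewrite inE; apply: (iffP forall_inP) => P a aN; apply/eqP/P. Qed.

Lemma local_degreeM l x g h :
  g \in perp l x -> local_degree l x h -> local_degree l x (g * h)%g.
Proof. by move=> /perpP pg Sh a Na; rewrite charM pg // mul1r Sh. Qed.

Fact chil_perp_group_set l x : group_set (chil @: perp l x).
Proof.
apply/group_setP; split=> [|_ _ /imsetP[g /perpP gN ->]
  /imsetP[h /perpP hN ->]].
  apply/imsetP; exists 1%g; first by apply/perpP => a _; rewrite char1.
  by apply: (mulgI (chil 1%g)); rewrite -chilM !mulg1.
rewrite -chilM imset_f //; apply/perpP => a Na.
by rewrite charM gN // hN // mulr1.
Qed.

Lemma stab_perp l x a : {in perp l x, forall g, (a : X) g = 1} ->
  a \in stab l x.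
Proof.
move=> aP; apply: contraT => aN.
have [g gN ag] := @subgroup_separate k G char_k (stab_group l x) a aN.
by rewrite aP ?eqxx // in ag; apply/perpP.
Qed.

(** If [a] were outside the subgroup [chil @: perp u y], some [g] would be killed by that subgroup
    but not by [a]. Then [chi beta g] is 1 on [perp u y], hence lies in [stab u y], so [g] satisfies
    [stabG] and [a g = 1], a contradiction. *)
Lemma orth_stabG u y a : orth (stabG beta D u y) a ->
  exists2 g, g \in perp u y & a = chil g.
Proof.
move=> oa; suff /imsetP[g gP ->] : a \in chil @: perp u y by exists g.
apply: contraT => aN.
have [g gN ag] := @subgroup_separate k G char_k
  (Group (chil_perp_group_set u y)) a aN.
have Ng : stabG beta D u y g.
  apply/stabP/stab_perp => h hP.
  by rewrite chiE -chilE; apply: gN; rewrite imset_f.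
by rewrite oa ?eqxx in ag.
Qed.

(** For any local degree [h], the quotient of [a] by [chil h] is orthogonal to [stabG], hence equals
    [chil g] with [g] in [perp u y]; multiplying [h] by [g] absorbs it. *)
Lemma rho_preim_local_degree u y a : rho_preim beta D u y a ->
  exists2 h, local_degree u y h & a = chil h.
Proof.
move=> ra; have [h Sh] := local_degree_exists u y.
have [|g gP aE] := @orth_stabG u y (a * (chil h)^-1)%g.
  move=> z z_u; rewrite charMl charVl (ra z z_u) chilE -chiE.
  by rewrite (Sh _ (introT (stabP _ _ _) z_u)) mulfV //;
    apply: ext_scal_neq0 (DP _) _ _.
exists (g * h)%g; first exact: local_degreeM.
by rewrite chilM -aE mulgKV.
Qed.

Lemma support_conditions :
    (forall g h, graded_support gr g -> graded_support gr h -> beta g h = 1) ->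
  color_conditions beta D.
Proof.
move=> betaS.
have betaD l x u y g h : local_degree l x g -> local_degree u y h ->
  beta h g = 1.
  by move=> Sg Sh; apply: betaS;
    [exact: local_degree_support Sh | exact: local_degree_support Sg].
have stabD l x u y h : local_degree u y h -> chil h \in stab l x.
  move=> Sh; apply: stab_perp => g gP; rewrite chilE.
  (* [g] is the quotient of the local degrees [g * g0] and [g0], which both pair trivially with
     [h]. *)
  have [g0 Sg0] := local_degree_exists l x.
  have := betaD _ _ _ _ _ _ (local_degreeM gP Sg0) Sh.
  by rewrite bichar_mulr (betaD _ _ _ _ _ _ Sg0 Sh) mulr1.
split=> [u l y x a /orth_stabG[g gP ->]|u l y x|u l y x a _
  /rho_preim_local_degree[h Sh ->]].
(* Again as a quotient: [chil (g * h)] and [chil h] both lie in the stabilizer, hence so does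
   [chil g]. *)
- have [h Sh] := local_degree_exists u y; apply/stabP.
  rewrite -(groupMr (G := stab_group l x) _ (stabD l x _ _ _ Sh)) /= -chilM.
  by apply: stabD (local_degreeM gP Sh).
- have [h Sh] := local_degree_exists u y; exists (chil h); split.
    exact/stabP/stabD/Sh.
  by move=> z /stabP Nz; rewrite chilE -chiE Sh.
(* The scalar is [phi] at [chil h], an element of the stabilizer, so any local degree [g] evaluates
   it as [beta h g]. *)
have [g Sg] := local_degree_exists l x.
by rewrite -[LHS]/(phi_lx D l x _) -Sg ?chilE;
  [exact: betaD Sg Sh | exact: stabD Sh].
Qed.

End Conditions.

End Support.

(** * Homogeneous components and the color Hopf structure *)

Section ColorHopf.
Variable beta : bichar k G.
Hypothesis abG : abelian [set: G].

Lemma char_dual_sum (g : G) : \sum_(a : X) a g = (#|{: X}| * (g == 1%g))%:R.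
Proof.
have [->|g1] := eqVneq g 1%g.
  rewrite muln1 (eq_bigr (fun=> 1)) => [|a _]; last exact: char1.
  by rewrite sumr_const.
have [b bg] := char_separate char_k abG g1.
rewrite muln0; apply/eqP; move: bg; rewrite -subr_eq0.
apply: contraNT => s0; apply/eqP/(mulIf s0).
rewrite mul0r mulrBl mul1r; apply/eqP; rewrite subr_eq0; apply/eqP.
rewrite mulr_sumr [RHS](reindex_inj (mulgI b)) /=.
by apply: eq_bigr => a _; rewrite charMl.
Qed.

(** Fourier component of degree [g]. The factor [#|G|%:R^-1] makes the sum over [g] the identity by
    orthogonality; on its own component the map is the nonzero scalar [#|{: X}|%:R / #|G|%:R]. *)
Definition grproj (g : G) : 'End(H) :=
  #|G|%:R^-1 *: \sum_(a : X) (a g)^-1 *: rho a.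

Lemma grprojE g v : grproj g v = #|G|%:R^-1 *: \sum_(a : X) (a g)^-1 *: rho a v.
Proof.
rewrite scale_lfunE sum_lfunE; congr (_ *: _).
by apply: eq_bigr => a _; rewrite scale_lfunE.
Qed.

Let cardG0 : #|G|%:R != 0 :> k.
Proof. exact: (natr_card_neq0 char_k 1%g). Qed.
Let cardX0 : #|{: X}|%:R != 0 :> k.
Proof. exact: (natr_card_neq0 char_k (1%g : X)). Qed.

Lemma grproj_gr g v : gr g (grproj g v).
Proof.
move=> b; rewrite grprojE homZ hom_sum scalerA mulrC -scalerA; congr (_ *: _).
rewrite scaler_sumr [RHS](reindex_inj (mulgI b)).
apply: eq_bigr => a _; rewrite homZ rhoM scalerA charMl invfM mulVKf //.
exact: char_neq0.
Qed.

Lemma sum_grproj v : \sum_g grproj g v = v.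
Proof.
under eq_bigr do rewrite grprojE; rewrite -scaler_sumr exchange_big.
under eq_bigr => a _.
  rewrite -scaler_suml (eq_bigr (a^-1)%g) => [|g _]; last by rewrite charVl.
  rewrite char_sum // invg_eq1; over.
rewrite (bigD1 1%g) //= eqxx muln1 big1 => [|a /negbTE ->];
  last by rewrite muln0 scale0r.
by rewrite addr0 rho1 scalerA mulVf // scale1r.
Qed.

Lemma grproj_of_gr g h v : gr g v ->
  grproj h v = (#|{: X}|%:R / #|G|%:R * (g == h)%:R) *: v.
Proof.
move=> vg; rewrite grprojE.
rewrite (eq_bigr (fun a : X => a (g * h^-1)%g *: v)) => [|a _].
  rewrite -scaler_suml scalerA char_dual_sum -eq_mulgV1 natrM mulrA.
  by rewrite [_^-1 * _]mulrC.
by rewrite vg scalerA charM charV mulrC.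
Qed.

Lemma induced_is_grading : is_grading gr.
Proof.
split=> [g a|g c x y xg yg a|x]; first by rewrite hom0 scaler0.
  by rewrite hom_lin xg yg scalerDr !scalerA mulrC.
exists [ffun g => grproj g x]; split.
  split=> [g|]; first by rewrite ffunE; apply: grproj_gr.
  by under eq_bigr do rewrite ffunE; rewrite sum_grproj.
(* Up to a nonzero scalar, [grproj h] extracts the component of degree [h] from any homogeneous
   decomposition, which gives uniqueness. *)
have key (ys : {ffun G -> H}) h : (forall g, gr g (ys g)) -> 
    grproj h (\sum_g ys g) = (#|{: X}|%:R / #|G|%:R) *: ys h.
  move=> ysP; rewrite hom_sum (bigD1 h) //= big1 => [|g /negbTE gh].
    by rewrite (grproj_of_gr _ (ysP h)) eqxx mulr1 addr0.
  by rewrite (grproj_of_gr _ (ysP g)) gh mulr0 scale0r.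
move=> ys [ysP xE]; apply/ffunP => h; rewrite ffunE.
have c0 : #|{: X}|%:R / #|G|%:R != 0 :> k by rewrite mulf_neq0 // invr_eq0.
apply: (scalerI c0).
rewrite -(key _ _ ysP) -xE.
have := key [ffun g => grproj g x] h; rewrite ffunE => <- => [|g].
  by under eq_bigr do rewrite ffunE; rewrite sum_grproj.
by rewrite ffunE; apply: grproj_gr.
Qed.

Lemma grproj_rho a g v : grproj g (rho a v) = a g *: grproj g v.
Proof.
rewrite !grprojE scalerA mulrC -scalerA; congr (_ *: _).
rewrite scaler_sumr [RHS](reindex_inj (mulIg a)).
apply: eq_bigr => b _; rewrite rhoM scalerA charMl invfM mulrCA mulfV ?mulr1 //.
exact: char_neq0.
Qed.

(** Since [rho a] commutes with the coproduct, this component is scaled both by [a g] and by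
    [a (h * h')]. A character separating [g] from [h * h'] forces it to vanish. *)
Lemma grproj_comul g h h' v : gr g v -> (h * h')%g != g ->
  tensmap (grproj h) (grproj h') (comulm B v) = 0.
Proof.
move=> vg hg; set T := tensmap _ _ _.
have T_rho (a : X) : a g *: T = a (h * h')%g *: T.
  have -> : a g *: T = tensmap (grproj h) (grproj h') (comulm B (rho a v)).
    by rewrite vg !homZ.
  rewrite (haut_comul (rho_hom.1 a).1) charM /T.
  elim/vec_ind: (comulm B v) => [c u u' IH IH'||[p q]].
  - by rewrite !hom_lin IH IH' scalerDr !scalerA mulrC.
  - by rewrite !hom0 scaler0.
  by rewrite -tens_bv !tensmap_tens !grproj_rho tensZl tensZr scalerA.
have /(char_separate char_k abG)[a] : (g^-1 * (h * h'))%g != 1%g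
  by rewrite -eq_mulVg1 eq_sym.
rewrite charM charV; apply: contraNeq => T0; apply/eqP.
have /eqP := T_rho a; rewrite -subr_eq0 -scalerBl scaler_eq0 (negbTE T0) orbF.
by rewrite subr_eq0 => /eqP <-; rewrite mulVf // char_neq0.
Qed.

Lemma tensmap_sum_grproj (t : vec k ((L * Gam) * (L * Gam))) :
  \sum_h \sum_h' tensmap (grproj h) (grproj h') t = t.
Proof.
elim/vec_ind: t => [c u u' IH IH'||[p q]].
- rewrite -{2}IH -{2}IH' scaler_sumr -big_split; apply: eq_bigr => h _.
  by rewrite scaler_sumr -big_split; apply: eq_bigr => h' _; rewrite hom_lin.
- by rewrite big1 // => h _; rewrite big1 // => h' _; rewrite hom0.
rewrite -tens_bv -{2}[bv k p]sum_grproj tens_suml; apply: eq_bigr => h _.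
rewrite -{2}[bv k q]sum_grproj tens_sumr; apply: eq_bigr => h' _.
by rewrite tensmap_tens.
Qed.

Lemma induced_comul_gr g v : gr g v -> tens_gr gr g (comulm B v).
Proof.
(* The tensors are indexed by the degree [h] of the left factor and a pair of basis vectors; the
   right factor is projected to degree [h^-1 * g]. *)
move=> vg; pose I := (G * ((L * Gam) * (L * Gam)))%type.
exists #|{: I}|, (fun i => (enum_val i).1), (fun i => (enum_val i).1^-1 * g)%g.
pose w (i : I) := (comulm B v i.2 : k) *: grproj i.1 (bv k i.2.1).
pose w' (i : I) := grproj (i.1^-1 * g)%g (bv k i.2.2).
exists (fun i => w (enum_val i)), (fun i => w' (enum_val i)); split.
  move=> i; split; last exact: mulKVg.
    move=> a; rewrite /w homZ grproj_gr !scalerA; congr (_ *: _); exact: mulrC.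
  exact: grproj_gr.
rewrite -(big_enum_val (fun i : I => tens (w i) (w' i)))
  -[LHS]tensmap_sum_grproj.
rewrite -(pair_big predT predT (fun h p => tens (w (h, p)) (w' (h, p)))) /=.
apply: eq_bigr => h _; rewrite (bigD1 (h^-1 * g)%g) //= big1 => [|h' hh'].
  rewrite addr0 [in LHS](vec_bvE (comulm B v)) hom_sum;
    apply: eq_bigr => -[p q] _.
  by rewrite homZ -tens_bv tensmap_tens tensZl.
apply: grproj_comul vg _; apply: contraNneq hh' => <-; by rewrite mulKg.
Qed.

Lemma support_color_hopf :
    (forall g h, graded_support gr g -> graded_support gr h -> beta g h = 1) ->
  color_hopf beta B gr.
Proof.
move=> betaS; split.
- exact: induced_is_grading.
- move=> g h x y xg yh a; rewrite (haut_mul (rho_hom.1 a).1) xg yh.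
  by rewrite tensZl tensZr scalerA homZ charM.
- by move=> a; rewrite (haut_unit (rho_hom.1 a).1) char1 scale1r.
- exact: induced_comul_gr.
- move=> g x xg /(char_separate char_k abG)[a ag].
  have := haut_counit (rho_hom.1 a).1 x; rewrite xg homZ => /eqP.
  rewrite -subr_eq0 -[X in _ - X]scale1r -scalerBl scaler_eq0 subr_eq0
    (negbTE ag).
  by move/eqP.
- exact: bismash_algebra.
- exact: bismash_coalgebra.
- exists (flip k _); split; last exact: bismash_comulM.
  move=> g h v w vg wh; rewrite flip_tens.
  (* Zero vectors are treated apart, since only nonzero ones witness membership in the support. *)
  have [->|v0] := eqVneq v 0; first by rewrite tens0r scaler0.
  have [->|w0] := eqVneq w 0; first by rewrite tens0l scaler0.
  by rewrite betaS ?scale1r //; [exists v | exists w].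
- exact: bismash_comul1.
- exact: bismash_counitM.
- exact: bismash_counit1.
exists (bismash_antipode k M); split.
- apply: inv_bij; exact: bismash_antipode_invol.
- move=> g x xg a; have [d dP] := ext_data_exists (rho_hom.1 a).
  by rewrite (ext_antipode (rho_hom.1 a) dP) xg homZ.
- exact: bismash_antipodel.
- exact: bismash_antipoder.
Qed.

Lemma color_hopf_support : color_hopf beta B gr ->
  forall g h, graded_support gr g -> graded_support gr h -> beta g h = 1.
Proof.
move=> cH g h [v vg v0] [w wh w0].
have [c [cB cM]] := color_braided cH.
have /eqP := cB _ _ _ _ vg wh; rewrite (braiding_unique cM) flip_tens eq_sym.
rewrite -subr_eq0 -[X in _ - X]scale1r -scalerBl scaler_eq0.
by rewrite (negbTE (tens_neq0 w0 v0)) orbF subr_eq0 => /eqP.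
Qed.

End ColorHopf.

End Main.

Theorem theorem4p13 (k : closedFieldType) (char_k : [pchar k] =i pred0)
    (G : finGroupType) (abG : abelian [set: G]) (beta : bichar k G)
    (Gam L : finGroupType) (M : matched_pair Gam L)
    (rho : char k G -> 'End(vec k (L * Gam)))
    (rho_hom : is_rho_hom M rho) :
  [<-> color_hopf beta (bismash k M) (induced_gr rho);
       (forall g h : G, graded_support (induced_gr rho) g ->
          graded_support (induced_gr rho) h -> beta g h = 1);
       color_matched_pair M beta rho].
Proof.
have support_color := support_color_hopf char_k rho_hom abG (beta := beta).
have color_support := color_hopf_support (M := M) (rho := rho) (beta := beta).
tfae.
- exact: color_support.
- move=> betaS; split=> //.
  (* Finiteness of the character group allows the data of all [rho a] to be chosen at once. *)
  have [D DP] := fin_all_exists (fun a => ext_data_exists (rho_hom.1 a)).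
  by exists D; split=> //; apply: (support_conditions char_k rho_hom DP betaS).
- case=> _ [D [DP cD]]; apply: support_color.
  exact: (conditions_support rho_hom DP cD).
Qed.
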